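(* Let $(X,d,\mu)$ be a metric measure space satisfying the geometric assumptions (finite measure of balls and measurability of $d$, non-degeneracy of balls, weak annular decay), and let $\mathcal{H}\subseteq L^2(X,\mu)$ be a reproducing kernel Hilbert space whose reproducing kernel $k$ satisfies the kernel assumptions (diagonal condition, weak localization, homogeneous approximation property), all of which are listed in the context. (i) If $\Lambda\subseteq X$ is a set of stable sampling for $\mathcal{H}$, then $D^-(\Lambda)\ge\mathrm{tr}^-(k)$ and $D^+(\Lambda)\ge\mathrm{tr}^+(k)$. (ii) If $\Lambda\subseteq X$ is a set of interpolation for $\mathcal{H}$, then $D^-(\Lambda)\le\mathrm{tr}^-(k)$ and $D^+(\Lambda)\le\mathrm{tr}^+(k)$.
   Context: Geometric assumptions. $(X,d)$ is a metric space and $\mu$ a measure on $X$ such that: $d:X\times X\to[0,\infty)$ is $\mu\otimes\mu$-measurable and the balls $B_r(x)=\{y\in X:d(x,y)<r\}$ satisfy $\mu(B_r(x))<\infty$ for all $r>0$, $x\in X$ (the $\sigma$-algebra of $\mu$ is not assumed to be generated by the $d$-open sets); (non-degeneracy of balls) there exists $r>0$ with $\inf_{x\in X}\mu(B_r(x))>0$; (weak annular decay) $\lim_{r\to\infty}\sup_{x\in X}\frac{\mu(B_{r+1}(x)\setminus B_r(x))}{\mu(B_r(x))}=0$. Kernel assumptions. $\mathcal{H}\subseteq L^2(X,\mu)$ is a Hilbert space of pointwise defined complex-valued functions on $X$ with the norm of $L^2(X,\mu)$, with reproducing kernel $k$: $f(x)=\int_X k(x,y)f(y)\,d\mu(y)=\langle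 f,k_x\rangle$ for all $f\in\mathcal{H}$, $x\in X$, where $k_x(y)=k(y,x)=\overline{k(x,y)}$, $k_x\in\mathcal{H}$. Moreover: (diagonal condition) there are constants $C_1,C_2>0$ with $C_1\le k(x,x)\le C_2$ for all $x\in X$; (weak localization) for every $\epsilon>0$ there is $r=r(\epsilon)$ with $\sup_{x\in X}\int_{X\setminus B_r(x)}|k(x,y)|^2\,d\mu(y)<\epsilon^2$; (homogeneous approximation property) whenever $\Lambda\subseteq X$ is such that $\{k_\lambda:\lambda\in\Lambda\}$ is a Bessel sequence for $\mathcal{H}$, i.e. $\sum_{\lambda\in\Lambda}|f(\lambda)|^2\le C\|f\|^2$ for some $C$ and all $f\in\mathcal{H}$, then for every $\epsilon>0$ there is $r=r(\epsilon)$ with $\sup_{x\in X}\sum_{\lambda\in\Lambda\setminus B_r(x)}|k(x,\lambda)|^2<\epsilon^2$. Definitions. $\Lambda\subseteq X$ is a set of (stable) sampling for $\mathcal{H}$ if there are $A,B>0$ with $A\|f\|^2\le\sum_{\lambda\in\Lambda}|f(\lambda)|^2\le B\|f\|^2$ for all $f\in\mathcal{H}$. It is a set of interpolation for $\mathcal{H}$ if for every $a\in\ell^2(\Lambda)$ there is $f\in\mathcal{H}$ with $f(\lambda)=a_\lambda$ for all $\lambda\in\Lambda$. The lower and upper Beurling densities are $$D^-(\Lambda)=\liminf_{r\to\infty}\inf_{x\in X}\frac{\#(\Lambda\cap B_r(x))}{\mu(B_r(x))},\qquad D^+(\Lambda)=\limsup_{r\to\infty}\sup_{x\in X}\frac{\#(\Lambda\cap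 B_r(x))}{\mu(B_r(x))},$$ and the lower and upper averaged traces are $$\mathrm{tr}^-(k)=\liminf_{r\to\infty}\inf_{x\in X}\frac{1}{\mu(B_r(x))}\int_{B_r(x)}k(y,y)\,d\mu(y),\qquad \mathrm{tr}^+(k)=\limsup_{r\to\infty}\sup_{x\in X}\frac{1}{\mu(B_r(x))}\int_{B_r(x)}k(y,y)\,d\mu(y).$$ *)

(* Defs.v *)
From HB Require Import structures.
From mathcomp Require Import all_boot all_order all_algebra.
From mathcomp Require Import all_classical all_reals all_analysis.
From mathcomp Require Import complex.

Set Implicit Arguments.
Unset Strict Implicit.
Unset Printing Implicit Defensive.

Import Order.TTheory GRing.Theory Num.Theory.
Import numFieldNormedType.Exports.

Local Open Scope classical_set_scope.
Local Open Scope ring_scope.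

(* The metric and the sigma-algebra are unrelated: the latter need not be      *)
(* generated by the open sets. Balls are measurable as soon as mdist is        *)
(* measurable for the product sigma-algebra.                                   *)
#[short(type="metricMeasurableType")]
HB.structure Definition MetricMeasurable (R : numDomainType)
    (d : measure_display) :=
  {X of Metric R X & Measurable d X}.

Section complex_L2.
Local Open Scope ereal_scope.
Context {R : realType} {d : measure_display} {X : measurableType d}.
Variable mu : {measure set X -> \bar R}.
Implicit Types (f g : X -> R[i]) (H : set (X -> R[i])).

Definition sqmod (z : R[i]) : \bar R := (Normc.normc z ^+ 2)%:E.

Definition cmeasurable f : Prop :=
  measurable_fun setT (fun x => complex.Re (f x)) /\
  measurable_fun setT (fun x => complex.Im (f x)).

Definition cintegral f : R[i] :=
  Complex (Rintegral mu setT (fun x => complex.Re (f x)))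
          (Rintegral mu setT (fun x => complex.Im (f x))).

(* The square of the L^2-norm. *)
Definition sqnorm f : \bar R := \int[mu]_x sqmod (f x).

Definition L2 f : Prop := cmeasurable f /\ sqnorm f < +oo.

(* H consists of genuine functions, not of classes modulo equality a.e., so    *)
(* the definiteness of the L^2-norm on H is a condition.                       *)
Record hilbert_space_of_functions H : Prop := {
  hilbert0 : H (fun=> 0%R) ;
  hilbert_lin : forall (a : R[i]) f g, H f -> H g ->
    H (fun x => a * f x + g x)%R ;
  hilbert_L2 : forall f, H f -> L2 f ;
  hilbert_definite : forall f, H f -> sqnorm f = 0 -> forall x, f x = 0%R ;
  hilbert_complete : forall u : nat -> X -> R[i], (forall n, H (u n)) ->
    (forall e : R, (0 < e)%R -> exists N, forall m n, (N <= m)%N -> (N <= n)%N ->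
       sqnorm (u m \- u n)%R < (e ^+ 2)%:E) ->
    exists2 f, H f & sqnorm (u n \- f)%R @[n --> \oo] --> 0 }.

Record reproducing_kernel H (k : X -> X -> R[i]) : Prop := {
  kernel_herm : forall x y, k y x = conjc (k x y) ;
  kernel_mem : forall x, H (fun y => k y x) ;
  kernel_repr : forall f, H f -> forall x,
    f x = cintegral (fun y => k x y * f y)%R }.

Definition bessel H (Lam : set X) : Prop :=
  exists C : R, forall f, H f ->
    (\esum_(l in Lam) sqmod (f l) <= C%:E * sqnorm f)%E.

Definition sampling H (Lam : set X) : Prop :=
  exists A B : R, [/\ (0 < A)%R, (0 < B)%R & forall f, H f ->
    A%:E * sqnorm f <= (\esum_(l in Lam) sqmod (f l))%R /\
    (\esum_(l in Lam) sqmod (f l))%R <= B%:E * sqnorm f].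

(* A family in l^2(Lam) is given by a function on X, of which only the         *)
(* restriction to Lam is relevant.                                             *)
Definition interpolation H (Lam : set X) : Prop :=
  forall a : X -> R[i], (\esum_(l in Lam) sqmod (a l))%R < +oo ->
    exists2 f, H f & forall l, Lam l -> f l = a l.

End complex_L2.

Section assumptions.
Local Open Scope ereal_scope.
Context {R : realType} {d : measure_display} {X : metricMeasurableType R d}.
Variable mu : {measure set X -> \bar R}.

Record geometric_assumptions : Prop := {
  geom_meas : measurable_fun [set: X * X] (fun p => mdist p.1 p.2) ;
  geom_fin : forall (x : X) (r : R), (0 < r)%R -> mu (ball x r) < +oo ;
  geom_nondegenerate : exists2 r : R, (0 < r)%R &
    0 < ereal_inf (range (fun x : X => mu (ball x r))) ;
  geom_annular_decay :
    ereal_sup (range (fun x : X =>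
      mu (ball x (r + 1)%R `\` ball x r) / mu (ball x r)))
    @[r --> +oo%R] --> 0 }.

Record kernel_assumptions (H : set (X -> R[i])) (k : X -> X -> R[i]) : Prop := {
  (* this is the order of R[i], so k x x is real *)
  kernel_diagonal : exists C1 C2 : R, [/\ (0 < C1)%R, (0 < C2)%R &
    forall x, (C1%:C <= k x x <= C2%:C)%C%R] ;
  kernel_localization : forall e : R, (0 < e)%R -> exists2 r : R, (0 < r)%R &
    ereal_sup (range (fun x : X => \int[mu]_(y in ~` ball x r) sqmod (k x y)))
      < (e ^+ 2)%:E ;
  kernel_hap : forall Lam : set X, bessel mu H Lam ->
    forall e : R, (0 < e)%R -> exists2 r : R, (0 < r)%R &
    ereal_sup (range (fun x : X => (\esum_(l in Lam `\` ball x r) sqmod (k x l))%R))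
      < (e ^+ 2)%:E }.

(* In the quotients below, x / 0 = x * +oo for extended reals; under the       *)
(* geometric assumptions mu (ball x r) is positive for all large r.            *)

Definition lower_density (Lam : set X) : \bar R :=
  limf_einf (fun r : R => ereal_inf (range (fun x : X =>
    counting (Lam `&` ball x r) / mu (ball x r)))) (pinfty_nbhs R).

Definition upper_density (Lam : set X) : \bar R :=
  limf_esup (fun r : R => ereal_sup (range (fun x : X =>
    counting (Lam `&` ball x r) / mu (ball x r)))) (pinfty_nbhs R).

Definition averaged_trace (k : X -> X -> R[i]) (x : X) (r : R) : \bar R :=
  (\int[mu]_(y in ball x r) (complex.Re (k y y))%:E) / mu (ball x r).

Definition lower_trace (k : X -> X -> R[i]) : \bar R :=
  limf_einf (fun r : R => ereal_inf (range (fun x : X => averaged_trace k x r)))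
    (pinfty_nbhs R).

Definition upper_trace (k : X -> X -> R[i]) : \bar R :=
  limf_esup (fun r : R => ereal_sup (range (fun x : X => averaged_trace k x r)))
    (pinfty_nbhs R).

End assumptions.

(* Main.v *)
Require Import Defs.
From mathcomp Require Import all_boot all_order all_algebra.
From mathcomp Require Import all_classical all_reals all_analysis.
From mathcomp Require Import finmap measurable_realfun complex ring lra.

(** The counting function of Lam and the integral of k y y over a large ball are
both compared with the dimension of a finite-dimensional space attached to the
points of Lam in that ball (the method of Ramanathan-Steger and of
Nitzan-Olevskii).

Everything is done with the real inner product Re <f, g>. A point x then gives
two evaluation vectors, k_x and i k_x, which represent the real and the
imaginary part of f x; all dimensions and all kernel diagonals are doubled, and
the factors 2 cancel.

Sampling. On H the form [f, g] = sum over Lam of Re (f l * conj (g l)) is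
equivalent to the inner product, so the Riesz theorem gives the dual frame
vectors T k_l, where T is the inverse of the frame operator. Let F be the finite
set of points of Lam in the ball of radius r about x, and V the span of T k_l
for l in F, of dimension at most #F. In the expansion of k_y as the sum of
k_y(l) T k_l over Lam, the terms with l outside F are negligible when y lies
at depth rho inside the ball, by the homogeneous approximation property. So k_y
is close to V (frame_approximation), and k y y exceeds the diagonal of the
kernel of V by a small constant only. The integral of that diagonal over X is
dim V; the shell of width rho costs at most sup k y y times its measure, which
is negligible by annular decay. Hence the trace is at most the density.

Interpolation. A gliding hump argument gives interpolants of the unit vectors
with bounded norms (interpolation_uniform). Projecting them on the span of the
k_l for l in a finite part F of Lam in the ball gives a system g_l in that span,
biorthogonal to the k_l and bounded (kernel_dual_system). Then #F is the sum of
<k_l, g_l>. By weak localization these products are nearly integrals over the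
ball of radius r + rho, and the sum of k_l(y) conj (g_l(y)) is the diagonal of
the kernel of the span, hence at most k y y. So the density is at most the trace.

In both cases the inequality between the quotients holds up to e, for all large
r and uniformly in x, and passes to the lower and upper limits.

The function y |-> k y y is never integrated as a measurable function: it is only
bounded above or below by measurable functions, and the integral of nonnegative
functions is monotone in general (ge0_integral_le). *)

Set Implicit Arguments.
Unset Strict Implicit.
Unset Printing Implicit Defensive.

Import Order.TTheory GRing.Theory Num.Theory.
Import numFieldNormedType.Exports.

Local Open Scope classical_set_scope.
Local Open Scope ring_scope.

(** * Real inner products on a subspace *)

Section inner_products.
Context {R : realType} {E : lmodType R}.
Implicit Types (H : set E) (b : E -> E -> R).

Record subspace H : Prop := {
  subspace0 : H 0 ;
  subspaceP : forall (c : R) f g, H f -> H g -> H (c *: f + g) }.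

(** Semidefinite only: the same record serves for the L2 form over a subset of X and
for the sum over a subset of Lam, which can vanish at nonzero elements of H. *)
Record inner_on H b : Prop := {
  inner_sym : forall f g, H f -> H g -> b f g = b g f ;
  inner_lin : forall (c : R) f g h, H f -> H g -> H h ->
    b (c *: f + g) h = c * b f h + b g h ;
  inner_ge0 : forall f, H f -> 0 <= b f f }.

Section fixed.
Variables (H : set E) (b : E -> E -> R).
Hypotheses (sH : subspace H) (ib : inner_on H b).

Lemma subspaceZ (c : R) f : H f -> H (c *: f).
Proof.
by move=> Hf; rewrite -[_ *: _]addr0; apply: subspaceP => //; exact: subspace0.
Qed.

Lemma subspaceD f g : H f -> H g -> H (f + g).
Proof. by move=> Hf Hg; rewrite -[f]scale1r; apply: subspaceP. Qed.

Lemma subspaceB f g : H f -> H g -> H (f - g).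
Proof. by move=> Hf Hg; rewrite -scaleN1r addrC; apply: subspaceP. Qed.

Lemma subspace_sum (I : eqType) (s : seq I) (c : I -> R) (v : I -> E) :
  {in s, forall i, H (v i)} -> H (\sum_(i <- s) c i *: v i).
Proof.
move=> Hv; elim: s Hv => [|i s IHs] Hv; first by rewrite big_nil; exact: subspace0.
rewrite big_cons; apply: subspaceP => //; first exact/Hv/mem_head.
by apply: IHs => j js; apply: Hv; rewrite in_cons js orbT.
Qed.

Lemma inner0l g : H g -> b 0 g = 0.
Proof.
move=> Hg; have H0 := subspace0 sH.
by have := inner_lin ib 1 H0 H0 Hg; rewrite scaler0 addr0 mul1r; lra.
Qed.

Lemma innerZl (c : R) f g : H f -> H g -> b (c *: f) g = c * b f g.
Proof.
move=> Hf Hg; rewrite -[_ *: _]addr0 (inner_lin ib) ?inner0l ?addr0//.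
exact: subspace0.
Qed.

Lemma innerDl f g h : H f -> H g -> H h -> b (f + g) h = b f h + b g h.
Proof. by move=> Hf Hg Hh; rewrite -[f]scale1r (inner_lin ib)// mul1r scale1r. Qed.

Lemma innerBl f g h : H f -> H g -> H h -> b (f - g) h = b f h - b g h.
Proof.
by move=> Hf Hg Hh; rewrite -scaleN1r addrC (inner_lin ib)// mulN1r addrC.
Qed.

Lemma innerZr (c : R) f g : H f -> H g -> b f (c *: g) = c * b f g.
Proof.
move=> Hf Hg; rewrite (inner_sym ib)// ?innerZl// ?(inner_sym ib Hg Hf)//.
exact: subspaceZ.
Qed.

Lemma innerDr f g h : H f -> H g -> H h -> b f (g + h) = b f g + b f h.
Proof.
move=> Hf Hg Hh; rewrite (inner_sym ib)// ?innerDl//; last exact: subspaceD.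
by rewrite (inner_sym ib Hg Hf) (inner_sym ib Hh Hf).
Qed.

Lemma innerBr f g h : H f -> H g -> H h -> b f (g - h) = b f g - b f h.
Proof.
move=> Hf Hg Hh; rewrite (inner_sym ib)// ?innerBl//; last exact: subspaceB.
by rewrite (inner_sym ib Hg Hf) (inner_sym ib Hh Hf).
Qed.

Lemma inner_suml (I : eqType) (s : seq I) (c : I -> R) (v : I -> E) h :
  {in s, forall i, H (v i)} -> H h ->
  b (\sum_(i <- s) c i *: v i) h = \sum_(i <- s) c i * b (v i) h.
Proof.
move=> Hv Hh; elim: s Hv => [|i s IHs] Hv; first by rewrite !big_nil inner0l.
have Hs : {in s, forall i, H (v i)}.
  by move=> j js; apply: Hv; rewrite in_cons js orbT.
rewrite !big_cons (inner_lin ib) ?IHs//; first exact/Hv/mem_head.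
exact: subspace_sum.
Qed.

(** The discriminant bound behind Cauchy-Schwarz and behind the variational
argument of approximate_riesz. *)
Lemma nonneg_quadratic (a p c : R) : 0 <= a ->
  (forall t, 0 <= a * t ^+ 2 + 2 * p * t + c) -> p ^+ 2 <= a * c.
Proof.
rewrite le_eqVlt => /predU1P[<-|a0] ge0; last first.
  have := ge0 (- p / a); rewrite -(pmulr_rge0 _ a0).
  set l := (X in 0 <= X); have -> : l = a * c - p ^+ 2; last by lra.
  by rewrite /l; field; rewrite gt_eqF.
have [->|p0] := eqVneq p 0; first by rewrite expr2 !mul0r.
have := ge0 (- (c + 1) / (2 * p)).
set l := (X in 0 <= X); have -> : l = - 1; last by lra.
by rewrite /l; field.
Qed.

Lemma inner_sqrD (t : R) f g : H f -> H g ->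
  b (t *: g + f) (t *: g + f) = b g g * t ^+ 2 + 2 * b g f * t + b f f.
Proof.
move=> Hf Hg.
have Htg := subspaceZ t Hg; have Hs := subspaceP sH t Hg Hf.
rewrite (inner_lin ib)// !innerDr// !innerZr// (inner_sym ib Hf Hg); ring.
Qed.

Lemma innerB_le f g : H f -> H g -> b (f - g) (f - g) <= 2 * b f f + 2 * b g g.
Proof.
move=> Hf Hg; have Hp := subspaceD Hf Hg; have Hm := subspaceB Hf Hg.
have := inner_ge0 ib Hp.
rewrite (innerDl Hf Hg Hp) (innerDr Hf Hf Hg) (innerDr Hg Hf Hg).
rewrite (innerBl Hf Hg Hm) (innerBr Hf Hf Hg) (innerBr Hg Hf Hg).
rewrite (inner_sym ib Hg Hf); lra.
Qed.

Lemma cauchy_schwarz f g : H f -> H g -> b f g ^+ 2 <= b f f * b g g.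
Proof.
move=> Hf Hg; rewrite [leRHS]mulrC (inner_sym ib Hf Hg).
apply: nonneg_quadratic => [|t]; first exact: (inner_ge0 ib).
rewrite -inner_sqrD//; apply: (inner_ge0 ib); exact: subspaceP.
Qed.

Definition proj (es : seq E) w := \sum_(e <- es) b w e *: e.

(** Stated through its consequence for residuals, which is what the applications
use and what the inductive step of gram_schmidt preserves directly. *)
Record orthonormal (es : seq E) : Prop := {
  orthonormal_mem : {in es, forall e, H e} ;
  orthonormal_norm : {in es, forall e, b e e = 1} ;
  orthonormal_proj : forall w, H w -> {in es, forall e, b (w - proj es w) e = 0} }.

Lemma proj_mem es w : {in es, forall e, H e} -> H (proj es w).
Proof. by move=> Hes; apply: subspace_sum. Qed.

Lemma orthonormal_pythagoras es w : orthonormal es -> H w ->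
  b w w = b (w - proj es w) (w - proj es w) + \sum_(e <- es) b w e ^+ 2.
Proof.
move=> [Hes _ pes] Hw; have Hp := proj_mem w Hes.
have Hwp := subspaceB Hw Hp.
have rp : b (w - proj es w) (proj es w) = 0.
  rewrite (inner_sym ib)// inner_suml// big_seq big1// => e ees.
  by rewrite (inner_sym ib (Hes _ ees) Hwp) pes// mulr0.
have -> : \sum_(e <- es) b w e ^+ 2 = b w (proj es w).
  rewrite (inner_sym ib)// inner_suml//; apply: eq_big_seq => e ees.
  by rewrite (inner_sym ib (Hes _ ees) Hw).
rewrite innerBl// in rp.
by rewrite innerBr// !innerBl// (inner_sym ib Hp Hw); lra.
Qed.

Lemma proj_inner es w h : orthonormal es -> H w -> H h ->
  b h (proj es w) = \sum_(e <- es) b h e * b w e.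
Proof.
move=> [Hes _ _] Hw Hh; have Hp := proj_mem w Hes.
rewrite (inner_sym ib)// inner_suml//; apply: eq_big_seq => e ees.
by rewrite mulrC (inner_sym ib (Hes _ ees) Hh).
Qed.

(** The third property stands for the equality of the spans. It survives the
degenerate case, where a residual of norm zero is
discarded because Cauchy-Schwarz makes it orthogonal to everything. *)
Lemma gram_schmidt (vs : seq E) : {in vs, forall v, H v} ->
  exists es, [/\ (size es <= size vs)%N, orthonormal es &
    forall w, H w ->
      {in es, forall e, b w e = 0} <-> {in vs, forall v, b w v = 0}].
Proof.
elim: vs => [|v vs IHvs] Hvs.
  by exists [::]; split=> //; split=> // w Hw e.
have [|es [ses ones Oes]] := IHvs.
  by move=> w wvs; apply: Hvs; rewrite in_cons wvs orbT.
have Hv : H v by apply: Hvs; rewrite mem_head.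
have [Hes nes pes] := ones.
have Hp := proj_mem v Hes.
set u := v - proj es v; have Hu : H u by exact: subspaceB.
have eu : {in es, forall e, b u e = 0} by exact: pes.
have bwv w : H w -> {in es, forall e, b w e = 0} -> b w v = b w u.
  move=> Hw we; rewrite innerBr// proj_inner// big_seq big1 ?subr0// => e ees.
  by rewrite we// mul0r.
have [u0|u0] := eqVneq (b u u) 0.
  exists es; split => //; first exact: leqW.
  move=> w Hw; split=> [we x|we]; last first.
    by apply: (Oes w Hw).2 => // x xvs; apply: we; rewrite in_cons xvs orbT.
  rewrite in_cons => /predU1P[->|]; last exact: (Oes w Hw).1 we x.
  rewrite bwv//; have := cauchy_schwarz Hw Hu; rewrite u0 mulr0.
  by move=> /(conj (sqr_ge0 (b w u))) /andP; rewrite -eq_le eq_sym sqrf_eq0 => /eqP.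
have upos : 0 < b u u by rewrite lt_neqAle eq_sym u0; exact: (inner_ge0 ib).
set c := (Num.sqrt (b u u))^-1; set e0 := c *: u.
have c0 : c != 0 by rewrite invr_eq0 sqrtr_eq0 -ltNge.
have cc : c * c * b u u = 1.
  by rewrite -expr2 exprVn sqr_sqrtr ?mulVf// ltW.
have He0 : H e0 by exact: subspaceZ.
have e0e : {in es, forall e, b e0 e = 0}.
  by move=> e ees; rewrite innerZl ?eu ?mulr0//; exact: Hes.
have ne0 : b e0 e0 = 1 by rewrite innerZl// innerZr// mulrA.
have Hes' : {in e0 :: es, forall e, H e}.
  by move=> e; rewrite in_cons => /predU1P[->//|]; exact: Hes.
exists (e0 :: es); split => //.
  split=> //.
    by move=> e; rewrite in_cons => /predU1P[->//|]; exact: nes.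
  move=> w Hw e; have Hpw := proj_mem w Hes.
  have Hwp := subspaceB Hw Hpw; have Hbe := subspaceZ (b w e0) He0.
  rewrite /proj big_cons -/(proj es w) opprD addrA addrAC.
  rewrite in_cons => /predU1P[->|ees].
    rewrite !innerBl// innerZl// ne0 (inner_sym ib Hpw He0) proj_inner//.
    rewrite big_seq big1 ?subr0 ?mulr1 ?subrr// => e' e'es.
    by rewrite e0e// mul0r.
  have He := Hes _ ees.
  by rewrite innerBl// pes// innerZl// e0e// mulr0 subr0.
move=> w Hw; split=> we x; rewrite in_cons => /predU1P[->|xs].
- have we' : {in es, forall e, b w e = 0}.
    by move=> e ees; apply: we; rewrite in_cons ees orbT.
  have := we e0 (mem_head _ _); rewrite innerZr// bwv// => /eqP.
  by rewrite mulf_eq0 (negbTE c0) => /eqP.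
- apply: (Oes w Hw).1 xs => e ees.
  by apply: we; rewrite in_cons ees orbT.
- have we' : {in es, forall e, b w e = 0}.
    by apply: (Oes w Hw).2 => // y yvs; apply: we; rewrite in_cons yvs orbT.
  by rewrite innerZr// -bwv// we ?mulr0// mem_head.
- by apply: (Oes w Hw).2 xs => y yvs; apply: we; rewrite in_cons yvs orbT.
Qed.

(** The middle expression is the squared norm of the projection p of z on the span
of the v i. The last hypothesis says that the g i lie in that span; it makes
z - p orthogonal to p. *)
Lemma biorthogonal_kernel_bound (I : finType) (v g : I -> E) z :
  (forall i, H (v i)) -> (forall i, H (g i)) -> H z ->
  (forall i j, b (v i) (g j) = (i == j)%:R) ->
  (forall w, H w -> (forall i, b w (v i) = 0) -> forall i, b w (g i) = 0) ->
  0 <= \sum_i b (v i) z * b (g i) z <= b z z.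
Proof.
move=> Hv Hg Hz vg spang.
pose p := \sum_i b (v i) z *: g i.
have Hp : H p by apply: subspace_sum.
have vp i : b p (v i) = b z (v i).
  rewrite inner_suml// (bigD1 i)//= (inner_sym ib (Hg i) (Hv i)) vg eqxx mulr1.
  rewrite big1 ?addr0; first exact: (inner_sym ib).
  by move=> j /negPf ji; rewrite (inner_sym ib (Hg j) (Hv i)) vg eq_sym ji mulr0.
have Hzp : H (z - p) by exact: subspaceB.
have zpg i : b (z - p) (g i) = 0.
  by apply: spang => // j; rewrite innerBl// vp subrr.
have sE : \sum_i b (v i) z * b (g i) z = b p z by rewrite inner_suml.
have zpp : b (z - p) p = 0.
  rewrite (inner_sym ib)// inner_suml// big1// => i _.
  by rewrite (inner_sym ib (Hg i) Hzp) zpg mulr0.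
rewrite innerBl// in zpp.
have := inner_ge0 ib Hzp; rewrite innerBr// !innerBl// sE (inner_sym ib Hz Hp).
have := inner_ge0 ib Hp; rewrite (inner_sym ib Hz Hp) in zpp; lra.
Qed.

(** The projection of f i on the span of the v i has the same products with the
v i as f i, and a smaller norm. *)
Lemma biorthogonal_exists (I : finType) (v f : I -> E) :
  (forall i, H (v i)) -> (forall i, H (f i)) ->
  (forall i j, b (v i) (f j) = (i == j)%:R) ->
  exists g : I -> E, [/\ (forall i, H (g i)),
    (forall i j, b (v i) (g j) = (i == j)%:R),
    (forall w, H w -> (forall i, b w (v i) = 0) -> forall i, b w (g i) = 0) &
    forall i, b (g i) (g i) <= b (f i) (f i)].
Proof.
move=> Hv Hf vf; have [|es [_ ones Oes]] := @gram_schmidt (codom v).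
  by move=> _ /codomP[i ->].
have [Hes nes pes] := ones.
have Hp w := proj_mem w Hes.
exists (fun i => proj es (f i)); split => //.
- move=> i j; have : b (f j - proj es (f j)) (v i) = 0.
    apply: ((Oes _ _).1 (pes _ _)) => //; first exact: subspaceB.
    exact: codom_f.
  rewrite innerBl// (inner_sym ib (Hf j) (Hv i)) (inner_sym ib (Hp _) (Hv i)) vf.
  by lra.
- move=> w Hw wv i; rewrite proj_inner// big_seq big1// => e ees.
  suff -> : b w e = 0 by rewrite mul0r.
  by apply: ((Oes w Hw).2 _) ees => _ /codomP[j ->].
- move=> i; rewrite proj_inner//.
  rewrite (orthonormal_pythagoras ones (Hf i)).
  have := inner_ge0 ib (subspaceB (Hf i) (Hp (f i))).
  have -> : \sum_(e <- es) b (proj es (f i)) e * b (f i) e =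
            \sum_(e <- es) b (f i) e ^+ 2.
    apply: eq_big_seq => e ees; have := pes _ (Hf i) _ ees.
    have He := Hes _ ees.
    by rewrite innerBl// expr2; move/eqP; rewrite subr_eq0 => /eqP <-.
  lra.
Qed.

End fixed.

Definition complete_for H b := forall u : nat -> E, (forall n, H (u n)) ->
  (forall e : R, 0 < e -> exists N, forall m n, (N <= m)%N -> (N <= n)%N ->
     b (u m - u n) (u m - u n) < e) ->
  exists2 f, H f & forall e : R, 0 < e -> exists N, forall n, (N <= n)%N ->
     b (u n - f) (u n - f) < e.

Section riesz.
Variables (H : set E) (b q : E -> E -> R) (A B : R).
Hypotheses (sH : subspace H) (ib : inner_on H b) (iq : inner_on H q).
Hypotheses (A0 : 0 < A) (Ab : forall f, H f -> A * b f f <= q f f)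
  (Bb : forall f, H f -> q f f <= B * b f f).

(** An almost minimiser u of q h h - 2 b h f almost satisfies the Euler equation:
perturbing u by t g gives a quadratic polynomial in t bounded below by - e. *)
Lemma approximate_riesz f (e : R) : H f -> 0 < e ->
  exists2 u, H u & forall g, H g -> (q g u - b g f) ^+ 2 <= e * q g g.
Proof.
move=> Hf e0.
pose J h := q h h - 2 * b h f.
have Jlb h : H h -> - (b f f / A) <= J h.
  (* completing the square *)
  move=> Hh; have := inner_ge0 ib (subspaceP sH (- A) Hh Hf).
  rewrite (inner_sqrD sH ib)// => sq; have := Ab Hh.
  have : 0 <= (b h h * (- A) ^+ 2 + 2 * b h f * - A + b f f) / A.
    by rewrite divr_ge0// ltW.
  have -> : (b h h * (- A) ^+ 2 + 2 * b h f * - A + b f f) / A =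
     A * b h h - 2 * b h f + b f f / A by field; rewrite gt_eqF.
  rewrite /J; lra.
have hi : has_inf [set J h | h in H].
  split; first by exists (J 0); exists 0 => //; exact: subspace0.
  by exists (- (b f f / A)) => _ [h Hh <-]; exact: Jlb.
have [_ [u Hu <-] Ju] := inf_adherent e0 hi.
exists u => // g Hg.
rewrite [leRHS]mulrC; apply: nonneg_quadratic; first exact: (inner_ge0 iq).
move=> t; have Htg := subspaceP sH t Hg Hu.
have : J u < J (t *: g + u) + e.
  by apply: lt_le_trans Ju _; rewrite lerD2r; exact: (ge_inf hi.2 (imageP J Htg)).
rewrite /J (inner_sqrD sH iq)// (inner_lin ib)//; lra.
Qed.

(** Almost representers for errors tending to 0 differ little in the norm of q,
hence form a Cauchy sequence for b, and their limit represents exactly. *)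
Lemma riesz f : complete_for H b -> H f ->
  exists2 u, H u & forall g, H g -> q g u = b g f.
Proof.
move=> cH Hf.
pose d n : R := n.+1%:R^-1.
have d0 n : 0 < d n by rewrite invr_gt0.
have dle m n : (m <= n)%N -> d n <= d m.
  by move=> mn; rewrite lef_pV2 ?posrE// ler_nat.
have dsmall (e : R) : 0 < e -> exists N, d N < e.
  move=> e0; exists (Num.truncn e^-1); rewrite /d invf_plt ?posrE//.
  by rewrite truncnS_gt.
have /choice[u uP] : forall n, exists u, H u /\
    forall g, H g -> (q g u - b g f) ^+ 2 <= d n * q g g.
  by move=> n; have [u Hu uP] := approximate_riesz Hf (d0 n); exists u.
have Hu n : H (u n) by case: (uP n).
have uB g m n : H g -> (q g (u m) - q g (u n)) ^+ 2 <= 2 * (d m + d n) * q g g.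
  move=> Hg; have := (uP m).2 g Hg; have := (uP n).2 g Hg.
  set x := q g (u m) - _; set y := q g (u n) - _ => yn xm.
  have -> : q g (u m) - q g (u n) = x - y by rewrite /x /y; ring.
  have := sqr_ge0 (x + y); nra.
have ucauchy m n : A * b (u m - u n) (u m - u n) <= 2 * (d m + d n).
  have Hd : H (u m - u n) by exact: subspaceB.
  have := uB _ m n Hd; rewrite -(innerBr sH iq)// expr2.
  have := Ab Hd; have := inner_ge0 iq Hd; set s := q _ _.
  rewrite le_eqVlt => /predU1P[<-|s0].
    by move=> + _; have := d0 m; have := d0 n; lra.
  by rewrite ler_pM2r//; lra.
have [e e0|v Hv uv] := cH u Hu.
  have [N Nd] := dsmall (A * e / 4) (divr_gt0 (mulr_gt0 A0 e0) (ltr0Sn _ _)).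
  exists N => m n Nm Nn; rewrite -(ltr_pM2l A0).
  have := ucauchy m n; have := dle _ _ Nm; have := dle _ _ Nn; lra.
exists v => // g Hg.
apply/eqP; rewrite -subr_eq0 -sqrf_eq0 eq_le sqr_ge0 andbT.
apply/ler_addgt0Pl => e e0; rewrite addr0.
have Hqg := inner_ge0 iq Hg.
have c0 : 0 < 2 * (`|B| + 1) * (q g g + 1).
  by rewrite mulr_gt0//; have := normr_ge0 B; lra.
have [N Nuv] := uv _ (divr_gt0 e0 c0).
have [M Md] := dsmall _ (divr_gt0 e0 c0).
set n := maxn N M; have {}Nuv := Nuv n (leq_maxl _ _).
have {Md dle}nd := le_lt_trans (dle _ _ (leq_maxr N M)) Md; rewrite -/n in nd.
have Hd : H (u n - v) by exact: subspaceB.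
have := (uP n).2 g Hg; have := cauchy_schwarz sH iq Hg Hd.
rewrite (innerBr sH iq)//.
have := Bb Hd; move: Nuv nd; set y := b (u n - v) _.
set z := q (u n - v) _; set x1 := q g (u n) - _; set x2 := q g (u n) - _.
have -> : q g v - b g f = x2 - x1 by rewrite /x1 /x2; ring.
move=> yk dk zy x1z x2d.
have y0 : 0 <= y by exact: (inner_ge0 ib).
have Bn : B <= `|B| by exact: ler_norm.
have zy' : z <= `|B| * y by apply: le_trans zy _; exact: ler_wpM2r.
have k0 : 0 < e / (2 * (`|B| + 1) * (q g g + 1)) by exact: divr_gt0.
set k := e / _ in yk dk k0.
have ek : e = k * (2 * (`|B| + 1) * (q g g + 1)).
  by rewrite /k mulfVK// gt_eqF.
have zk : z <= `|B| * k.
  by apply: le_trans zy' _; apply: ler_wpM2l => //; exact: ltW.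
have s1 : x1 ^+ 2 <= q g g * (`|B| * k).
  by apply: le_trans x1z _; exact: ler_wpM2l.
have s2 : x2 ^+ 2 <= q g g * k.
  by apply: le_trans x2d _; rewrite mulrC; apply: ler_wpM2l => //; exact: ltW.
have s3 : (x2 - x1) ^+ 2 <= 2 * (x1 ^+ 2 + x2 ^+ 2).
  by have := sqr_ge0 (x1 + x2); nra.
have s4 : 0 <= k * (`|B| + 1) by rewrite mulr_ge0 ?addr_ge0// ltW.
have -> : e = 2 * (q g g * (`|B| * k) + q g g * k) + 2 * (k * (`|B| + 1)).
  by rewrite ek; ring.
lra.
Qed.

End riesz.
End inner_products.

(** * Polarised forms of positive functionals *)

Section forms.
Context {R : realType} {X : Type}.
Local Notation E := (X -> Rcomplex R).

Definition rdot (z w : R[i]) : R :=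
  complex.Re z * complex.Re w + complex.Im z * complex.Im w.

Definition energy (f : X -> R[i]) (x : X) : R := rdot (f x) (f x).

Lemma energy_ge0 f x : 0 <= energy f x.
Proof. by rewrite addr_ge0// -expr2 sqr_ge0. Qed.

Lemma sqmodE (z : R[i]) : sqmod z = (rdot z z)%:E.
Proof.
by case: z => a b; rewrite /sqmod /= sqr_sqrtr ?addr_ge0 ?sqr_ge0// !expr2.
Qed.

Lemma energyDB (f g : E) x :
  energy (f + g) x = 4 * rdot (f x) (g x) + energy (f - g) x.
Proof.
rewrite /energy !fctE; case: (f x) => a b; case: (g x) => c d.
rewrite /rdot/=; ring.
Qed.

Local Open Scope ereal_scope.

(** Common interface of u |-> integral of u over a measurable set and
u |-> sum of u over a subset of X; M is the class of measurable functions in the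
first case and of all functions in the second. *)
Record positive_functional (M : set (X -> R)) (Phi : (X -> R) -> \bar R) : Prop := {
  functionalD : forall u v, M u -> M v ->
    (forall x, 0 <= u x)%R -> (forall x, 0 <= v x)%R ->
    M (u \+ v)%R /\ Phi (u \+ v)%R = Phi u + Phi v ;
  functionalZ : forall (c : R) u, (0 <= c)%R -> M u -> (forall x, 0 <= u x)%R ->
    M (fun x => c * u x)%R /\ Phi (fun x => c * u x)%R = c%:E * Phi u ;
  functional_ge0 : forall u, (forall x, 0 <= u x)%R -> 0 <= Phi u }.

(** The bilinear form attached to Phi, obtained by polarisation from the quadratic
form f |-> Phi (energy f). Defining it through nonnegative integrands only avoids
summability questions for the products of two functions. *)
Definition form (Phi : (X -> R) -> \bar R) (f g : E) : R :=
  ((fine (Phi (energy (f + g)%R)) - fine (Phi (energy (f - g)%R))) / 4)%R.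

Section form_theory.
Variables (M : set (X -> R)) (Phi : (X -> R) -> \bar R) (H : set E).
Hypotheses (pPhi : positive_functional M Phi) (sH : subspace H).
Hypothesis finH : forall f, H f -> M (energy f) /\ Phi (energy f) < +oo.

Local Notation q f := (fine (Phi (energy f))).

Lemma energy_fin_num f : H f -> Phi (energy f) \is a fin_num.
Proof.
move=> /finH[_ fy]; rewrite ge0_fin_numE//.
apply: (functional_ge0 pPhi); exact: energy_ge0.
Qed.

(** Identities between the quadratic form at several vectors follow from pointwise
identities between energies with nonnegative coefficients. *)
Lemma energy_lincomb (c : R) f g h : (0 <= c)%R -> H f -> H g -> H h ->
  fine (Phi (fun x => c * energy f x + energy g x + energy h x)%R) =
  (c * q f + q g + q h)%R.
Proof.
move=> c0 Hf Hg Hh.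
have [[[Mf _] [Mg _]] [Mh _]] := (finH Hf, finH Hg, finH Hh).
have [Mcf Ecf] := functionalZ pPhi c0 Mf (energy_ge0 f).
have cf0 x : (0 <= c * energy f x)%R by rewrite mulr_ge0 ?energy_ge0.
have [Ms Es] := functionalD pPhi Mcf Mg cf0 (energy_ge0 g).
have s0 x : (0 <= (fun x => c * energy f x)%R x + energy g x)%R.
  by rewrite addr_ge0 ?energy_ge0.
have [_ +] := functionalD pPhi Ms Mh s0 (energy_ge0 h).
rewrite /GRing.add_fun/= => ->; rewrite Es Ecf.
have [[ff fg] fh] := (energy_fin_num Hf, energy_fin_num Hg, energy_fin_num Hh).
by rewrite !fineD ?fineM// ?fin_numM// fin_numD fin_numM.
Qed.

Lemma form_diag f : H f -> form Phi f f = q f.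
Proof.
move=> Hf; rewrite /form.
have H0 := subspace0 sH.
have -> : energy (f + f)%R =
    (fun x => 4 * energy f x + energy (0%R : E) x + energy (0%R : E) x)%R.
  apply/funext => x; rewrite /energy !fctE; case: (f x) => a b; rewrite /rdot/=; ring.
rewrite subrr energy_lincomb//.
have -> : q (0%R : E) = 0%R; last by field.
have := energy_lincomb (ler0n _ 0) H0 H0 H0.
have -> : (fun x => 0 * energy (0%R : E) x + energy (0%R : E) x + energy (0%R : E) x)%R
   = energy (0%R : E).
  by apply/funext => x; rewrite /energy /rdot/=; ring.
lra.
Qed.

(** Bilinearity is a pointwise identity once all terms are moved to the side where
their coefficients are nonnegative; negative scalars are reduced to positive ones
by oddness. *)
Lemma form_inner : inner_on H (form Phi).
Proof.
have sym (f g : E) : form Phi f g = form Phi g f.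
  rewrite /form (addrC f g); suff -> : energy (f - g)%R = energy (g - f)%R by [].
  apply/funext => x; rewrite /energy !fctE.
  by case: (f x) => a b; case: (g x) => c d; rewrite /rdot/=; ring.
have pos (c : R) f g h : (0 <= c)%R -> H f -> H g -> H h ->
    form Phi (c *: f + g)%R h = (c * form Phi f h + form Phi g h)%R.
  move=> c0 Hf Hg Hh.
  have Hs := subspaceP sH c Hf Hg.
  have [Hfh Hfh'] := (subspaceD sH Hf Hh, subspaceB sH Hf Hh).
  have [Hgh Hgh'] := (subspaceD sH Hg Hh, subspaceB sH Hg Hh).
  have [Hsh Hsh'] := (subspaceD sH Hs Hh, subspaceB sH Hs Hh).
  have L := energy_lincomb c0 Hfh' Hsh Hgh'.
  have : (c * q (f + h)%R + q (c *: f + g - h)%R + q (g + h)%R =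
          c * q (f - h)%R + q (c *: f + g + h)%R + q (g - h)%R)%R.
    rewrite -!energy_lincomb//; congr (fine (Phi _)); apply/funext => x.
    rewrite /energy !fctE.
    by case: (f x) => a b; case: (g x) => a' b'; case: (h x) => p p'; rewrite /rdot/=; ring.
  rewrite /form; lra.
have neg (f g : E) : form Phi (- f)%R g = (- form Phi f g)%R.
  rewrite /form.
  have -> : energy (- f + g)%R = energy (f - g)%R.
    apply/funext => x; rewrite /energy !fctE.
    by case: (f x) => a b; case: (g x) => c d; rewrite /rdot/=; ring.
  have -> : energy (- f - g)%R = energy (f + g)%R; last by lra.
  apply/funext => x; rewrite /energy !fctE.
  by case: (f x) => a b; case: (g x) => c d; rewrite /rdot/=; ring.
split => [f g _ _|c f g h Hf Hg Hh|f Hf]; first exact: sym.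
- have [c0|c0] := leP 0%R c; first exact: pos.
  have -> : (c *: f = (- c) *: (- f))%R by rewrite scalerN scaleNr opprK.
  rewrite pos ?neg ?mulrNN//; first by rewrite oppr_ge0 ltW.
  by rewrite -scaleN1r; exact: subspaceZ.
- rewrite form_diag// fine_ge0//; apply: (functional_ge0 pPhi).
  exact: energy_ge0.
Qed.

Lemma functional_sum (I : Type) (s : seq I) (f : I -> E) : (forall i, H (f i)) ->
  M (fun x => \sum_(i <- s) energy (f i) x)%R /\
  Phi (fun x => \sum_(i <- s) energy (f i) x)%R = (\sum_(i <- s) q (f i))%:E.
Proof.
move=> Hf; have H0 := subspace0 sH.
elim: s => [|i s [IHM IHE]].
  have -> : (fun x => \sum_(i <- [::]) energy (f i) x)%R = energy (0%R : E).
    by apply/funext => x; rewrite big_nil /energy /rdot /= mul0r addr0.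
  split; first by case: (finH H0).
  rewrite big_nil -(fineK (energy_fin_num H0)); congr EFin.
  by rewrite -form_diag//; exact: inner0l sH form_inner _ H0.
have [Mi _] := finH (Hf i).
have s0 x : (0 <= \sum_(i <- s) energy (f i) x)%R.
  by apply: sumr_ge0 => j _; exact: energy_ge0.
have -> : (fun x => \sum_(i <- i :: s) energy (f i) x)%R =
   (energy (f i) \+ (fun x => \sum_(i <- s) energy (f i) x))%R.
  by apply/funext => x; rewrite big_cons.
have [M1 ->] := functionalD pPhi Mi IHM (energy_ge0 (f i)) s0.
by split => //; rewrite IHE big_cons EFinD fineK//; exact: energy_fin_num.
Qed.

(** The polarised form of Phi is Phi of the pointwise product, whenever a sum of
such products is nonnegative. Adding the energies of f i - g i makes both sides
sums of energies. *)
Lemma form_sum (I : Type) (s : seq I) (f g : I -> E)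
    (u := fun x => (\sum_(i <- s) rdot (f i x) (g i x))%R) :
  (forall i, H (f i)) -> (forall i, H (g i)) ->
  M u -> (forall x, 0 <= u x)%R ->
  Phi u = (\sum_(i <- s) form Phi (f i) (g i))%:E.
Proof.
move=> Hf Hg Mu u0.
have [MD ED] := functional_sum s (fun i => subspaceD sH (Hf i) (Hg i)).
have [MB EB] := functional_sum s (fun i => subspaceB sH (Hf i) (Hg i)).
have [M4u E4u] := functionalZ pPhi (ler0n _ 4) Mu u0.
have d0 x : (0 <= \sum_(i <- s) energy (f i - g i) x)%R.
  by apply: sumr_ge0 => j _; exact: energy_ge0.
have [_ +] := functionalD pPhi M4u MB (fun x => mulr_ge0 (ler0n _ 4) (u0 x)) d0.
have -> : ((fun x => 4 * u x) \+ (fun x => \sum_(i <- s) energy (f i - g i) x) =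
   (fun x => \sum_(i <- s) energy (f i + g i) x))%R.
  apply/funext => x; rewrite /GRing.add_fun /u mulr_sumr -big_split/=.
  by apply: eq_bigr => i _; rewrite [RHS]energyDB.
rewrite ED EB E4u.
have := functional_ge0 pPhi u0; case: (Phi u) => [r _|_|//]; last first.
  by rewrite gt0_muley ?lte_fin ?ltr0n// addye.
rewrite -EFinM -EFinD => -[Eq]; congr EFin.
rewrite /form -mulr_suml sumrB Eq; by field.
Qed.

End form_theory.

Lemma form_split (M : set (X -> R)) (Phi Phi1 Phi2 : (X -> R) -> \bar R) (H : set E) :
  positive_functional M Phi1 -> positive_functional M Phi2 -> subspace H ->
  (forall u, M u -> (forall x, 0 <= u x)%R -> Phi u = Phi1 u + Phi2 u) ->
  (forall f, H f -> M (energy f) /\ Phi1 (energy f) < +oo) ->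
  (forall f, H f -> M (energy f) /\ Phi2 (energy f) < +oo) ->
  forall f g, H f -> H g -> form Phi f g = (form Phi1 f g + form Phi2 f g)%R.
Proof.
move=> p1 p2 sH split fin1 fin2 f g Hf Hg.
have qE h : H h -> fine (Phi (energy h)) =
    (fine (Phi1 (energy h)) + fine (Phi2 (energy h)))%R.
  move=> Hh; rewrite split; last exact: energy_ge0; last by case: (fin1 h Hh).
  rewrite fineD//; first exact: energy_fin_num p1 fin1 _ Hh.
  exact: energy_fin_num p2 fin2 _ Hh.
rewrite /form !qE; [lra | exact: subspaceB | exact: subspaceD].
Qed.

End forms.

Section integral_functional.
Context {R : realType} {d : measure_display} {X : measurableType d}.
Variable mu : {measure set X -> \bar R}.
Local Open Scope ereal_scope.

Definition integral_on (D : set X) (u : X -> R) : \bar R := \int[mu]_(x in D) (u x)%:E.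

Lemma integral_on_positive D : measurable D ->
  positive_functional [set u | measurable_fun setT u] (integral_on D).
Proof.
move=> mD; split => [u v mu_ mv u0 v0|c u c0 mu_ u0|u u0].
- split; first exact: measurable_funD.
  rewrite /integral_on -ge0_integralD//.
  + by move=> x _; rewrite lee_fin.
  + by apply/measurable_EFinP; exact: measurable_funS mu_.
  + by move=> x _; rewrite lee_fin.
  + by apply/measurable_EFinP; exact: measurable_funS mv.
- split; first exact: measurable_funM.
  rewrite /integral_on; under eq_integral do rewrite EFinM.
  rewrite ge0_integralZl ?lee_fin//.
  + by apply/measurable_EFinP; exact: measurable_funS mu_.
  + by move=> x _; rewrite lee_fin.
- by apply: integral_ge0 => x _; rewrite lee_fin.
Qed.

Lemma integral_on_split (D : set X) (u : X -> R) : measurable D -> measurable_fun setT u ->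
  (forall x, 0 <= u x)%R ->
  integral_on setT u = integral_on D u + integral_on (~` D) u.
Proof.
move=> mD mu_ u0; rewrite /integral_on -ge0_integral_setU ?setUv//.
- exact: measurableC.
- exact/measurable_EFinP.
- by move=> x _; rewrite lee_fin.
- by rewrite disj_set2E setICr.
Qed.

End integral_functional.

Section esum_functional.
Context {R : realType} {X : choiceType}.
Local Open Scope ereal_scope.

Definition esum_on (L : set X) (u : X -> R) : \bar R := \esum_(x in L) (u x)%:E.

Lemma esumZl_le (L : set X) (c : R) (u : X -> \bar R) :
  (0 <= c)%R -> (forall x, 0 <= u x) ->
  \esum_(x in L) (c%:E * u x) <= c%:E * \esum_(x in L) u x.
Proof.
move=> c0 u0; apply: ge_ereal_sup => _ [A [fA AL] <-].
rewrite -ge0_mule_fsumr//; apply: lee_pmul => //; last first.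
  by apply: ereal_sup_ubound; exists A.
by apply: fsume_ge0 => x _.
Qed.

Lemma esum_on_positive (L : set X) : positive_functional setT (esum_on L).
Proof.
split => [u v _ _ u0 v0|c u c0 _ u0|u u0].
- by split => //; rewrite /esum_on -esumD// => x _; rewrite lee_fin.
- split => //; apply/eqP; rewrite eq_le; apply/andP; split.
    rewrite /esum_on; under eq_esum => x _ do rewrite EFinM.
    by apply: esumZl_le.
  have [->|cn0] := eqVneq c 0%R.
    by rewrite mul0e; apply: esum_ge0 => x _; rewrite mul0r.
  have {cn0} {}c0 : (0 < c)%R by rewrite lt_neqAle eq_sym cn0.
  rewrite -lee_pdivlMl// /esum_on.
  have -> : \esum_(x in L) (u x)%:E = \esum_(x in L) (c^-1%:E * (c * u x)%:E).
    by apply: eq_esum => x _; rewrite -EFinM mulKf// gt_eqF.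
  by apply: esumZl_le; rewrite ?invr_ge0 ?(ltW c0)// => x; rewrite lee_fin mulr_ge0// ltW.
- by apply: esum_ge0 => x _; rewrite lee_fin.
Qed.

End esum_functional.

(** * The function space as a real Hilbert space *)

Section function_space.
Context {R : realType} {d : measure_display} {X : measurableType d}.
Local Notation E := (X -> Rcomplex R).
Variable mu : {measure set X -> \bar R}.
Variables (H : set (X -> R[i])) (k : X -> X -> R[i]).
Hypothesis hilb : hilbert_space_of_functions mu H.
Hypothesis repr : reproducing_kernel mu H k.

Lemma hilbert_subspace : subspace (H : set E).
Proof.
split=> [|c f g Hf Hg]; first exact: hilbert0 hilb.
have -> : c *: f + g = (fun x => c%:C%C * (f x : R[i]) + g x).
  apply/funext => x; rewrite !fctE; case: (f x) => a b; case: (g x) => p q.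
  by apply/eqP; rewrite eq_complex /= !mul0r subr0 addr0 !eqxx.
exact: (hilbert_lin hilb).
Qed.

Lemma hilbert_imaginary f : H f -> H (fun x => 'i%C * f x).
Proof.
move=> Hf; have -> : (fun x => 'i%C * f x) = (fun x => 'i%C * f x + (fun=> 0) x).
  by apply/funext => x; rewrite addr0.
by apply: (hilbert_lin hilb) => //; exact: hilbert0 hilb.
Qed.

Lemma measurable_rdot (f g : X -> R[i]) : H f -> H g ->
  measurable_fun setT (fun x => rdot (f x) (g x)).
Proof.
move=> /(hilbert_L2 hilb)[[mf mf'] _] /(hilbert_L2 hilb)[[mg mg'] _].
by apply: measurable_funD; exact: measurable_funM.
Qed.

Lemma sqnorm_integral f : sqnorm mu f = integral_on mu setT (energy f).
Proof. by apply: eq_integral => x _; rewrite sqmodE. Qed.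

Lemma energy_integrable (D : set X) : measurable D -> forall f, H f ->
  [set u | measurable_fun setT u] (energy f) /\ (integral_on mu D (energy f) < +oo)%E.
Proof.
move=> mD f Hf; have me : measurable_fun setT (energy f) by exact: measurable_rdot.
split=> //; have [_] := hilbert_L2 hilb Hf; rewrite sqnorm_integral; apply: le_lt_trans.
apply: ge0_subset_integral => //; first exact/measurable_EFinP.
by move=> x _; rewrite lee_fin energy_ge0.
Qed.

Definition real_inner := form (integral_on mu setT).

Local Notation ip := real_inner.

Lemma ip_on_inner (D : set X) : measurable D ->
  inner_on (H : set E) (form (integral_on mu D)).
Proof.
move=> mD.
exact: form_inner (integral_on_positive mu mD) hilbert_subspace (energy_integrable mD).
Qed.

Lemma ip_inner : inner_on (H : set E) ip.
Proof. exact: ip_on_inner measurableT. Qed.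

Lemma ip_on_split (D : set X) : measurable D -> forall f g : E, H f -> H g ->
  ip f g = form (integral_on mu D) f g + form (integral_on mu (~` D)) f g.
Proof.
move=> mD; have mCD := measurableC mD.
apply: (form_split (integral_on_positive mu mD) (integral_on_positive mu mCD)
  hilbert_subspace _ (energy_integrable mD) (energy_integrable mCD)).
by move=> u mu_ u0; exact: integral_on_split.
Qed.

Lemma ip_on_le (D : set X) (f : E) : measurable D -> H f ->
  form (integral_on mu D) f f <= ip f f.
Proof.
move=> mD Hf; rewrite (ip_on_split mD)// lerDl.
exact: inner_ge0 (ip_on_inner (measurableC mD)) _ Hf.
Qed.

Lemma ip_on_diag (D : set X) (f : E) : measurable D -> H f ->
  integral_on mu D (energy f) = (form (integral_on mu D) f f)%:E.
Proof.
move=> mD Hf; have pD := integral_on_positive mu mD.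
rewrite (form_diag pD hilbert_subspace (energy_integrable mD))// fineK//.
exact: (energy_fin_num pD (energy_integrable mD)).
Qed.

Lemma sqnorm_ip (f : E) : H f -> sqnorm mu f = (ip f f)%:E.
Proof. by move=> Hf; rewrite sqnorm_integral; exact: ip_on_diag measurableT Hf. Qed.

Lemma hilbert_complete_ip : complete_for (H : set E) ip.
Proof.
move=> u Hu uC; have sH := hilbert_subspace.
have [e e0|f Hf fu] := @hilbert_complete _ _ _ _ _ hilb u Hu.
  have [N NP] := uC (e ^+ 2) (exprn_gt0 2 e0); exists N => m n Nm Nn.
  rewrite -[(u m \- u n)]/(u m - u n : E) sqnorm_ip;
    last exact: subspaceB sH _ _ (Hu m) (Hu n).
  by rewrite lte_fin; exact: NP.
exists f => // e e0.
have /fine_cvgP[_ /cvgrPdist_lt/(_ e e0)[N _ NP]] := fu.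
exists N => n Nn; have /= := NP n Nn; rewrite sub0r normrN.
rewrite -[(u n \- f)]/(u n - f : E) sqnorm_ip; last exact: subspaceB sH _ _ (Hu n) Hf.
exact: le_lt_trans (ler_norm _).
Qed.

Lemma ip_Rintegral (f g : E) : H f -> H g ->
  Rintegral mu setT (fun y => rdot (f y) (g y)) = ip f g.
Proof.
move=> Hf Hg; have sH := hilbert_subspace.
have integ (h : E) : H h -> mu.-integrable setT (EFin \o energy h).
  move=> /(energy_integrable measurableT)[me hy]; apply/integrableP; split.
    exact/measurable_EFinP.
  rewrite (eq_integral (fun x => (energy h x)%:E))// => x _.
  by rewrite /= ger0_norm// energy_ge0.
have [iD iB] := (integ _ (subspaceD sH Hf Hg), integ _ (subspaceB sH Hf Hg)).
have -> : (fun y => rdot (f y) (g y)) =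
    (fun y => 4^-1 * (energy (f + g) y - energy (f - g) y)).
  by apply/funext => y; rewrite energyDB; field.
rewrite RintegralZl//; last by have := integrableB measurableT iD iB.
by rewrite RintegralB// mulrC.
Qed.

Definition coordinate (t : bool) (z : R[i]) := if t then complex.Im z else complex.Re z.

(** k_x for t = false and i k_x for t = true: the vectors representing the real and
the imaginary part of the evaluation at x. *)
Definition kernel_at (x : X) (t : bool) : E :=
  if t then (fun y => 'i%C * k y x) else (fun y => k y x).

Lemma kernel_at_mem x t : H (kernel_at x t).
Proof.
by case: t; [apply: (@hilbert_imaginary (fun y => k y x))|]; exact: kernel_mem repr x.
Qed.

Lemma reproducing (f : E) x t : H f -> coordinate t (f x) = ip f (kernel_at x t).
Proof.
move=> Hf; rewrite -ip_Rintegral//; last exact: kernel_at_mem.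
rewrite {1}(kernel_repr repr Hf) /cintegral; case: t => /=;
  apply: eq_Rintegral => y _; rewrite (kernel_herm repr x y);
  by case: (f y) => a b; case: (k x y) => p q; rewrite /rdot/=; ring.
Qed.

Lemma rdot_ip (f g : E) x : H f -> H g ->
  rdot (f x) (g x) = \sum_t ip f (kernel_at x t) * ip g (kernel_at x t).
Proof. by move=> Hf Hg; rewrite big_bool -!reproducing// /rdot addrC. Qed.

Lemma kernel_at_norm x t :
  ip (kernel_at x t) (kernel_at x t) = complex.Re (k x x).
Proof.
rewrite -reproducing; last exact: kernel_at_mem.
by case: t => //=; case: (k x x) => a b; rewrite /= mul0r add0r mul1r.
Qed.

End function_space.

(** * Balls, annuli and limits over large radii *)

Section limits_at_infinity.
Context {R : realType} {X : Type}.
Variables (u v : X -> R -> \bar R).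
Local Open Scope ereal_scope.
Hypothesis uv : forall e : R, (0 < e)%R -> exists r0 : R, forall r, (r0 <= r)%R ->
  forall x, u x r <= v x r + e%:E.

Let shrink (V : set R) (r0 : R) : pinfty_nbhs R V ->
  pinfty_nbhs R (V `&` [set r | (r0 <= r)%R]).
Proof.
move=> [M [_ MV]]; exists (Num.max M r0); split; first exact: num_real.
move=> r; rewrite gt_max => /andP[Mr r0r]; split; [exact: MV|exact: ltW].
Qed.

Lemma limf_esup_sup_le :
  limf_esup (fun r => ereal_sup (range (u^~ r))) (pinfty_nbhs R) <=
  limf_esup (fun r => ereal_sup (range (v^~ r))) (pinfty_nbhs R).
Proof.
apply/lee_addgt0Pr => e /uv[r0 r0P]; rewrite -leeBlDr//.
rewrite [leRHS]limf_esupE; apply: le_ereal_inf_tmp => _ [V /(shrink r0) FV <-].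
rewrite leeBlDr// limf_esupE; apply: le_trans.
  by apply: ereal_inf_lbound; exists (V `&` [set r | (r0 <= r)%R]).
apply: ge_ereal_sup => _ [r [Vr r0r] <-]; apply: ge_ereal_sup => _ [x _ <-].
apply: (le_trans (r0P r r0r x)); apply: leeD => //.
apply: le_trans; last by apply: ereal_sup_ubound; exists r.
by apply: ereal_sup_ubound; exists x.
Qed.

Lemma limf_einf_inf_le :
  limf_einf (fun r => ereal_inf (range (u^~ r))) (pinfty_nbhs R) <=
  limf_einf (fun r => ereal_inf (range (v^~ r))) (pinfty_nbhs R).
Proof.
apply/lee_addgt0Pr => e /uv[r0 r0P]; rewrite [leLHS]limf_einfE.
apply: ge_ereal_sup => _ [V /(shrink r0) FV <-].
rewrite -leeBlDr// limf_einfE; apply: le_trans; last first.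
  by apply: ereal_sup_ubound; exists (V `&` [set r | (r0 <= r)%R]).
apply: le_ereal_inf_tmp => _ [r [Vr r0r] <-]; apply: le_ereal_inf_tmp => _ [x _ <-].
rewrite leeBlDr//; apply: (le_trans _ (r0P r r0r x)).
apply: le_trans; first by apply: ereal_inf_lbound; exists r.
by apply: ereal_inf_lbound; exists x.
Qed.

End limits_at_infinity.

Section geometry.
Context {R : realType} {d : measure_display} {X : metricMeasurableType R d}.
Variable mu : {measure set X -> \bar R}.
Hypothesis geom : geometric_assumptions mu.

Definition volume (x : X) (r : R) : R := fine (mu (ball x r)).

Lemma measurable_ball (x : X) (r : R) : measurable (ball x r : set X).
Proof.
rewrite ballEmdist.
have mx : measurable_fun setT (fun y : X => mdist x y).
  exact: (measurable_fun_pair2 x (geom_meas geom)).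
have -> : [set y : X | mdist x y < r] = setT `&` (fun y : X => mdist x y) @^-1` `]-oo, r[.
  by rewrite setTI; apply/seteqP; split => y /=; rewrite in_itv.
by apply: mx => //; exact: measurable_itv.
Qed.

Lemma volumeE x r : 0 < r -> mu (ball x r) = (volume x r)%:E.
Proof. by move=> r0; rewrite fineK// ge0_fin_numE//; exact: geom_fin geom x r r0. Qed.

Lemma measurable_annulus (x : X) (r s : R) : measurable (ball x s `\` ball x r : set X).
Proof. by apply: measurableD; exact: measurable_ball. Qed.

Lemma volume_gt0 : exists2 r0 : R, 0 < r0 & forall r, r0 <= r -> forall x, 0 < volume x r.
Proof.
have [r0 r00 inf0] := geom_nondegenerate geom; exists r0 => // r r0r x.
rewrite -lte_fin -volumeE ?(lt_le_trans r00)//.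
apply: lt_le_trans inf0 _; apply: le_trans; first by apply: ereal_inf_lbound; exists x.
by apply: le_measure; rewrite ?in_setE; try exact: measurable_ball; exact: le_ball.
Qed.

Lemma annulus_decay1 e : 0 < e -> exists r0, forall r, r0 <= r -> forall x,
  (mu (ball x (r + 1) `\` ball x r) <= (e * volume x r)%:E)%E.
Proof.
move=> e0; have [r1 r10 vpos] := volume_gt0.
have /fine_cvgP[[M [_ Mfin]] /cvgrPdist_lt/(_ e e0)[N [_ NP]]] := geom_annular_decay geom.
exists (Num.max (Num.max (M + 1) (N + 1)) r1) => r.
rewrite !ge_max -andbA => /and3P[Mr Nr r1r] x.
have v0 := vpos r r1r x.
have Nr' : N < r by lra.
have Mr' : M < r by lra.
have := NP r Nr'; have := Mfin r Mr'.
set S := ereal_sup _ => Sfin; rewrite /= sub0r normrN => Se.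
have : (S <= e%:E)%E.
  by rewrite -(fineK Sfin) lee_fin ltW//; exact: le_lt_trans (ler_norm _) Se.
have xS : (mu (ball x (r + 1) `\` ball x r) / mu (ball x r) <= S)%E.
  by apply: ereal_sup_ubound; exists x.
move=> /(le_trans xS); rewrite volumeE ?(lt_le_trans r10)// inver gt_eqF//.
by rewrite lee_pdivrMr// EFinM.
Qed.

Lemma volumeD (x : X) (r s : R) : 0 < r -> r <= s ->
  mu (ball x s) = ((volume x r)%:E + mu (ball x s `\` ball x r))%E.
Proof.
move=> r0 rs; rewrite -volumeE//.
rewrite -measureU ?setDIK//; try exact: measurable_ball; try exact: measurable_annulus.
by rewrite setDUK//; exact: le_ball.
Qed.

(** An annulus of width n is a union of n annuli of width 1, and the volumes of the
intermediate balls are comparable with the volume of the inner one. *)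
Lemma annulus_decay (rho e : R) : 0 < e -> exists r0, forall r, r0 <= r -> forall x,
  (mu (ball x (r + rho) `\` ball x r) <= (e * volume x r)%:E)%E.
Proof.
move=> e0.
suff [n rn [r0 r0P]] : exists2 n : nat, rho <= n%:R & exists r0, forall r, r0 <= r ->
    forall x, (mu (ball x (r + n%:R) `\` ball x r) <= (e * volume x r)%:E)%E.
  exists r0 => r r0r x; apply: le_trans (r0P r r0r x).
  apply: le_measure; rewrite ?in_setE; try exact: measurable_annulus.
  by apply: setSD; apply: le_ball; rewrite lerD2l.
exists (Num.truncn rho).+1; first by rewrite ltW// truncnS_gt.
elim: (Num.truncn rho).+1 e e0 => {rho} [|n IHn] e e0.
  have [r0 r00 vpos] := volume_gt0; exists r0 => r r0r x.
  by rewrite addr0 setDv measure0 lee_fin mulr_ge0 ?ltW// vpos.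
(* with e1 <= 1, e1 (1 + e1) + e1 <= 3 e1 <= e *)
pose e1 := Num.min 1 (e / 3).
have e10 : 0 < e1 by rewrite lt_min ltr01 divr_gt0.
have e11 : e1 <= 1 by rewrite ge_min lexx.
have e13 : e1 <= e / 3 by rewrite ge_min lexx orbT.
have [r1 r1P] := IHn e1 e10; have [r2 r2P] := annulus_decay1 e10.
have [r3 r30 vpos] := volume_gt0.
exists (Num.max (Num.max r1 r2) r3) => r; rewrite !ge_max -andbA => /and3P[r1r r2r r3r] x.
have rr : 0 < r := lt_le_trans r30 r3r.
have v0 := vpos r r3r x.
have rrn : r <= r + n%:R by rewrite lerDl.
have P1 := r1P r r1r x; have P2 := r2P (r + n%:R) (le_trans r2r rrn) x.
have vn : volume x (r + n%:R) <= (1 + e1) * volume x r.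
  rewrite -lee_fin -volumeE; last by rewrite (lt_le_trans rr).
  by rewrite (volumeD x rr rrn) mulrDl mul1r EFinD leeD2l.
apply: (@le_trans _ _ (mu (ball x (r + n%:R + 1) `\` ball x (r + n%:R)) +
                       mu (ball x (r + n%:R) `\` ball x r))%E).
  apply: (le_trans _ (measureU2 _ _ _)); try exact: measurable_annulus.
  apply: le_measure; rewrite ?in_setE; try exact: measurable_annulus.
    by apply: measurableU; exact: measurable_annulus.
  rewrite -natr1 addrA => y [ys yr]; have [yn|yn] := pselect (ball x (r + n%:R) y).
    by right.
  by left.
apply: (le_trans (leeD P2 P1)); rewrite -EFinD lee_fin.
have := ler_wpM2l (ltW e10) vn.
have : e1 * (1 + e1) * volume x r <= e1 * 2 * volume x r.
  by apply: ler_wpM2r; [exact: ltW|apply: ler_wpM2l; [exact: ltW|lra]].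
have : e1 * volume x r <= e / 3 * volume x r by apply: ler_wpM2r => //; exact: ltW.
rewrite mulrA; lra.
Qed.

End geometry.

(** * Sampling: approximation of kernels by dual frame vectors *)

(** The integral of a nonnegative function is the supremum over the simple functions
below it, hence monotone for all such functions. This is what allows bounds on the integral
of y |-> k y y, of which measurability is not known. *)
Lemma ge0_integral_le {d : measure_display} {T : measurableType d} {R : realType}
    (mu : {measure set T -> \bar R}) (D : set T) (f g : T -> \bar R) :
  (forall x, D x -> (0 <= f x)%E) -> (forall x, D x -> (f x <= g x)%E) ->
  (\int[mu]_(x in D) f x <= \int[mu]_(x in D) g x)%E.
Proof.
move=> f0 fg; have g0 x : D x -> (0 <= g x)%E.
  by move=> Dx; exact: le_trans (f0 x Dx) (fg x Dx).
rewrite !ge0_integralE//; apply: le_ereal_sup => _ [h hf <-].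
exists h => // x; apply: le_trans (hf x) _.
by rewrite /patch; case: ifPn => // /set_mem /fg.
Qed.

Lemma finite_set_seq (R : realType) (X : choiceType) (S : set X) : finite_set S ->
  exists s : seq X, [/\ uniq s, (size s)%:R%:E = counting S :> \bar R & [set` s] = S].
Proof.
move=> fS; exists (enum_fset (fset_set S)); split; first exact: fset_uniq.
  by rewrite /counting asboolT.
by rewrite -[RHS](fset_setK fS).
Qed.

Section sampling.
Context {R : realType} {d : measure_display} {X : metricMeasurableType R d}.
Local Notation E := (X -> Rcomplex R).
Variable mu : {measure set X -> \bar R}.
Variables (H : set (X -> R[i])) (k : X -> X -> R[i]).
Hypothesis geom : geometric_assumptions mu.
Hypothesis hilb : hilbert_space_of_functions mu H.
Hypothesis repr : reproducing_kernel mu H k.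
Local Notation ip := (real_inner mu).

Lemma energy_kernel_at x t y : (energy (kernel_at k x t) y)%:E = sqmod (k x y).
Proof.
rewrite sqmodE /energy (kernel_herm repr y x) /kernel_at.
by congr EFin; case: t; case: (k y x) => a b; rewrite /rdot/=; ring.
Qed.

Section frame.
Variables (Lam : set X) (A B : R).
Hypothesis A0 : 0 < A.
Hypothesis samp : forall f, H f ->
  (A%:E * sqnorm mu f <= \esum_(l in Lam) sqmod (f l))%E /\
  (\esum_(l in Lam) sqmod (f l) <= B%:E * sqnorm mu f)%E.

Let energy_esum (L : set X) (f : E) :
  (\esum_(l in L) sqmod (f l))%E = esum_on L (energy f).
Proof. by apply: eq_esum => l _; rewrite sqmodE. Qed.

Let energy_summable (L : set X) : L `<=` Lam -> forall f, H f ->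
  setT (energy f) /\ (esum_on L (energy f) < +oo)%E.
Proof.
move=> LLam f Hf; split => //.
have := (samp Hf).2; rewrite energy_esum (sqnorm_ip hilb)// -EFinM => Bf.
apply: le_lt_trans (ltry _); apply: le_trans Bf.
rewrite /esum_on (esumID L Lam); last by move=> i _; rewrite lee_fin energy_ge0.
rewrite setIidr//; apply: leeDl; apply: esum_ge0 => i _.
by rewrite lee_fin energy_ge0.
Qed.

Let sample_form (L : set X) : E -> E -> R := form (@esum_on R X L).

Let sample_form_inner (L : set X) : L `<=` Lam -> inner_on (H : set E) (sample_form L).
Proof.
move=> LLam.
exact: form_inner (esum_on_positive L) (hilbert_subspace hilb) (energy_summable LLam).
Qed.

Let sample_form_diag (L : set X) (f : E) : L `<=` Lam -> H f ->
  esum_on L (energy f) = (sample_form L f f)%:E.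
Proof.
move=> LLam Hf; have pL := @esum_on_positive R X L.
rewrite /sample_form (form_diag pL (hilbert_subspace hilb) (energy_summable LLam))//.
rewrite fineK//.
exact: (energy_fin_num pL (energy_summable LLam)).
Qed.

Let sample_form_bounds (f : E) : H f ->
  A * ip f f <= sample_form Lam f f /\ sample_form Lam f f <= B * ip f f.
Proof.
move=> Hf; have := samp Hf.
by rewrite energy_esum (sqnorm_ip hilb)// sample_form_diag// -!EFinM !lee_fin.
Qed.

Let sample_form_split (F : set X) (f g : E) : H f -> H g ->
  sample_form Lam f g = sample_form (Lam `&` F) f g + sample_form (Lam `&` ~` F) f g.
Proof.
move=> Hf Hg; have sub (S : set X) : Lam `&` S `<=` Lam by exact: subIsetl.
apply: (form_split (esum_on_positive (Lam `&` F)) (esum_on_positive (Lam `&` ~` F))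
  (hilbert_subspace hilb) _ (energy_summable (sub F)) (energy_summable (sub (~` F)))) => //.
move=> u _ u0; rewrite /esum_on (esumID F)// => i _.
by rewrite lee_fin.
Qed.

(** The system es is an orthonormal basis of the span V of the dual vectors T k_l and
T (i k_l), for l in s. Let w be the component of k_y orthogonal to V, and h = T w.
Then h vanishes on s, so <w, w> = <k_y, w> = [k_y, h] is a sum over the points
of Lam outside s, and Cauchy-Schwarz together with A [h, h] <= <w, w> gives the
bound. *)
Lemma frame_approximation (s : seq X) : [set` s] `<=` Lam ->
  exists es : seq E, [/\ (size es <= size s * 2)%N, orthonormal (H : set E) ip es &
    forall y t w, w = kernel_at k y t - proj ip es (kernel_at k y t) ->
      ((A * ip w w)%:E <= \esum_(l in Lam `&` ~` [set` s]) sqmod (k y l))%E].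
Proof.
move=> sLam; have sH := hilbert_subspace hilb; have ipi := ip_inner hilb.
have qi := sample_form_inner (@subset_refl _ Lam).
have /choice[T TP] : forall f : E, exists u : E, H f ->
    H u /\ forall g, H g -> sample_form Lam g u = ip g f.
  move=> f; have [Hf|nHf] := pselect (H f); last by exists 0.
  have [u Hu uf] := riesz sH ipi qi A0 (fun f Hf => (sample_form_bounds Hf).1)
    (fun f Hf => (sample_form_bounds Hf).2) (hilbert_complete_ip hilb) Hf.
  by exists u.
have Hk := kernel_at_mem hilb repr.
pose vs := [seq T (kernel_at k l t) | l <- s, t <- [:: false; true]].
have Hvs : {in vs, forall v, (H : set E) v}.
  by move=> _ /allpairsP[[l t] /= [_ _ ->]]; exact: (TP _ (Hk l t)).1.
have [es [ses ones Oes]] := gram_schmidt sH ipi Hvs.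
have [Hes nes pes] := ones.
exists es; split => //; first by move: ses; rewrite size_allpairs.
move=> y t w; set z := kernel_at k y t => wE.
have Hz : H z by exact: Hk.
have Hp := proj_mem ip sH z Hes.
have Hw : H w by rewrite wE; exact: subspaceB sH _ _ Hz Hp.
have we : {in es, forall e, ip w e = 0} by rewrite wE; exact: pes.
have [Hh hw] := TP _ Hw; set h := T w in Hh hw.
(* <h, k_l> = [h, T k_l] = <w, T k_l> = 0 *)
have h0 l : l \in s -> h l = 0.
  move=> ls.
  have hl t' : coordinate t' (h l) = 0.
    rewrite (reproducing hilb repr)//.
    have [HT] := TP _ (Hk l t'); move=> <- //.
    rewrite (inner_sym qi)// hw// (inner_sym ipi)//.
    apply: (Oes w Hw).1; first exact: we.
    by apply/allpairsP; exists (l, t'); split=> //; case: (t').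
  have := hl true; have := hl false; case: (h l) => a b /= -> ->.
  by [].
have wwzh : ip w w = sample_form (Lam `&` ~` [set` s]) z h.
  have -> : ip w w = ip z w.
    rewrite {1}wE (innerBl ipi)// (inner_sym ipi Hp Hw) (proj_inner sH ipi ones)//.
    by rewrite big_seq big1 ?subr0// => e ees; rewrite we// mul0r.
  rewrite -hw// (sample_form_split [set` s])// [X in X + _](_ : _ = 0) ?add0r//.
  rewrite /sample_form /form.
  suff -> : esum_on (Lam `&` [set` s]) (energy (z + h)) =
            esum_on (Lam `&` [set` s]) (energy (z - h)) by rewrite subrr mul0r.
  apply: eq_esum => l [_ /= ls].
  by rewrite energyDB (h0 _ ls) /rdot/= !mulr0 addr0 mulr0 add0r.
have subs : Lam `&` ~` [set` s] `<=` Lam by exact: subIsetl.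
have qi' := sample_form_inner subs.
have hh : sample_form (Lam `&` ~` [set` s]) h h <= sample_form Lam h h.
  rewrite (sample_form_split [set` s] Hh Hh) lerDr.
  exact: inner_ge0 (sample_form_inner (@subIsetl _ Lam [set` s])) h Hh.
have zzE : (\esum_(l in Lam `&` ~` [set` s]) sqmod (k y l))%E =
    (sample_form (Lam `&` ~` [set` s]) z z)%:E.
  rewrite -sample_form_diag//; apply: eq_esum => l _.
  by rewrite energy_kernel_at.
rewrite zzE lee_fin.
have cs := cauchy_schwarz sH qi' Hz Hh; rewrite -wwzh in cs.
have [Ah _] := sample_form_bounds Hh; have qhh := hw h Hh.
have cs2 := cauchy_schwarz sH ipi Hh Hw; rewrite -qhh in cs2.
have zz0 := inner_ge0 qi' Hz; have ww0 := inner_ge0 ipi Hw.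
have qh0 := inner_ge0 qi Hh; have ih0 := inner_ge0 ipi Hh.
move: cs cs2 Ah hh zz0 ww0 qh0 ih0.
set a := ip w w; set zz := sample_form _ z z.
set qh' := sample_form _ h h; set qh := sample_form Lam h h.
set ih := ip h h => cs cs2 Ah hh zz0 ww0 qh0 ih0.
have [->|qn0] := eqVneq a 0; first by rewrite mulr0.
have {qn0} a0 : 0 < a by rewrite lt_neqAle eq_sym qn0.
(* qh^2 = <h, w>^2 <= <h, h> <w, w> <= (qh / A) <w, w> *)
have Aqh : A * qh <= a.
  have [->|qn0] := eqVneq qh 0; first by rewrite mulr0.
  have {qn0} q0 : 0 < qh by rewrite lt_neqAle eq_sym qn0.
  rewrite -(ler_pM2l q0); apply: (@le_trans _ _ (A * (ih * a))).
    by rewrite mulrCA -expr2 ler_wpM2l// ltW.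
  by rewrite mulrA ler_wpM2r.
rewrite -(ler_pM2l a0); apply: (@le_trans _ _ (A * (zz * qh'))).
  by rewrite mulrCA -expr2 ler_wpM2l// ltW.
have : zz * (A * qh') <= zz * a.
  by apply: ler_wpM2l => //; apply: le_trans Aqh; rewrite ler_wpM2l// ltW.
by rewrite mulrCA [zz * a]mulrC.
Qed.

End frame.
End sampling.

(** * Sampling: the averaged trace is at most the density *)

Lemma esum_le_subset {R : realType} {T : choiceType} (I J : set T) (a : T -> \bar R) :
  I `<=` J -> (forall i, J i -> (0 <= a i)%E) ->
  (\esum_(i in I) a i <= \esum_(i in J) a i)%E.
Proof.
move=> IJ a0; rewrite [leRHS](esumID I)// setIidr//.
by apply: leeDl; apply: esum_ge0 => i [/a0].
Qed.

Section sampling.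
Context {R : realType} {d : measure_display} {X : metricMeasurableType R d}.
Local Notation E := (X -> Rcomplex R).
Variable mu : {measure set X -> \bar R}.
Variables (H : set (X -> R[i])) (k : X -> X -> R[i]).
Hypothesis geom : geometric_assumptions mu.
Hypothesis hilb : hilbert_space_of_functions mu H.
Hypothesis repr : reproducing_kernel mu H k.
Hypothesis kern : kernel_assumptions mu H k.
Local Notation ip := (real_inner mu).

Definition total_energy (es : seq E) (y : X) : R := \sum_(e <- es) energy e y.

Lemma kernel_diagonal_bounds : exists2 C : R, 0 < C &
  forall y, 0 <= complex.Re (k y y) <= C.
Proof.
have [C1 [C2 [C10 C20 kC]]] := kernel_diagonal kern; exists C2 => // y.
move: (kC y); rewrite !lecE /= => /andP[/andP[_ C1k] /andP[_ ->]].
by rewrite (le_trans (ltW C10) C1k).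
Qed.

(** The total energy is the diagonal of the kernel of the span, summed over the two
evaluation vectors; over all of X its integral is the real dimension. *)
Lemma orthonormal_energy_le (es : seq E) (D : set X) : measurable D ->
  orthonormal (H : set E) ip es ->
  measurable_fun setT (total_energy es) /\
  (integral_on mu D (total_energy es) <= (size es)%:R%:E)%E.
Proof.
move=> mD [Hes nes _]; have sH := hilbert_subspace hilb.
have Hn i : H (if (i < size es)%N then nth 0 es i else 0 : E).
  by case: ifP => [ies|_]; [exact/Hes/mem_nth|exact: subspace0 sH].
have pD := integral_on_positive mu mD.
have [mS SE] :=
  functional_sum pD sH (energy_integrable hilb mD) (index_iota 0 (size es)) Hn.
have Eq : (total_energy es) =
   (fun y => \sum_(i <- index_iota 0 (size es))
      energy (if (i < size es)%N then nth 0 es i else 0 : E) y).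
  apply/funext => y; rewrite /total_energy (big_nth 0) big_seq [RHS]big_seq.
  by apply: eq_bigr => i; rewrite mem_index_iota /= => ->.
rewrite Eq SE; split => //; rewrite lee_fin.
have -> : (size es)%:R = \sum_(i <- index_iota 0 (size es)) (1 : R).
  by rewrite big_const_seq count_predT size_iota subn0 iter_addr_0.
rewrite big_seq [leRHS]big_seq; apply: ler_sum => i.
rewrite mem_index_iota /= => ies; rewrite ies.
have Hi : H (nth 0 es i) by exact/Hes/mem_nth.
rewrite -[leLHS](form_diag pD sH (energy_integrable hilb mD))//.
by rewrite -(nes (nth 0 es i)) ?mem_nth//; exact: (ip_on_le hilb).
Qed.

(** Inside S the kernel diagonal is bounded by the kernel of the span up to c, and
outside S by its supremum. *)
Lemma local_trace_le (C c : R) (es : seq E) (D S : set X) :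
  measurable D -> measurable S -> S `<=` D -> 0 <= C -> 0 <= c ->
  (forall y, 0 <= complex.Re (k y y) <= C) ->
  orthonormal (H : set E) ip es ->
  (forall y, S y -> 2 * complex.Re (k y y) <= 2 * c + total_energy es y) ->
  (\int[mu]_(y in D) (complex.Re (k y y))%:E <=
   c%:E * mu D + (size es)%:R%:E / 2%:E + C%:E * mu (D `\` S))%E.
Proof.
move=> mD mS SD C0 c0 kC ones kS.
have [mes esle] := orthonormal_energy_le mD ones.
have s0 y : 0 <= total_energy es y.
  by apply: sumr_ge0 => e _; exact: energy_ge0.
have mDS : measurable (D `\` S) by exact: measurableD.
pose m1 (y : X) : \bar R := c%:E.
pose m2 (y : X) : \bar R := (2^-1%:E * (total_energy es y)%:E)%E.
pose m3 (y : X) : \bar R := (C%:E * (\1_(D `\` S) y)%:E)%E.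
have m20 y : (0 <= m2 y)%E by rewrite /m2 -EFinM lee_fin mulr_ge0// invr_ge0.
have m30 y : (0 <= m3 y)%E by rewrite /m3 -EFinM lee_fin mulr_ge0.
have mm2 : measurable_fun D m2.
  apply: measurable_funeM; apply/measurable_EFinP; exact: measurable_funS mes.
have mi : measurable_fun D (fun y => (\1_(D `\` S) y)%:E : \bar R).
  by apply/measurable_EFinP; exact: measurable_indic.
have mm3 : measurable_fun D m3 by exact: measurable_funeM.
have mm1 : measurable_fun D m1 by exact: measurable_cst.
apply: (@le_trans _ _ (\int[mu]_(y in D) (m1 y + m2 y + m3 y))%E).
  apply: ge0_integral_le => y Dy; first by rewrite lee_fin; case/andP: (kC y).
  have [Sy|nSy] := pselect (S y).
    have m12 : ((complex.Re (k y y))%:E <= m1 y + m2 y)%E.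
      by rewrite /m1 /m2 -EFinM -EFinD lee_fin; have := kS y Sy; lra.
    by rewrite -[leLHS]adde0; exact: leeD.
  have -> : m3 y = C%:E.
    by rewrite /m3 indicE mem_set ?mule1//; split.
  rewrite -[leLHS]add0e; apply: leeD; first by rewrite adde_ge0// lee_fin.
  by rewrite lee_fin; case/andP: (kC y).
rewrite ge0_integralD//; last 2 first.
  by move=> y _; rewrite adde_ge0// lee_fin.
  by apply: emeasurable_funD.
rewrite ge0_integralD//.
apply: leeD; [apply: leeD|].
- by rewrite integral_cst.
- rewrite ge0_integralZl ?lee_fin ?invr_ge0//; last 2 first.
    by apply/measurable_EFinP; exact: measurable_funS mes.
    by move=> y _; rewrite lee_fin.
  rewrite inver pnatr_eq0/= muleC; apply: lee_pmul => //.
  + by apply: integral_ge0 => y _; rewrite lee_fin.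
- rewrite ge0_integralZl//.
  by rewrite integral_indic// setIidl//; exact: subDsetl.
Qed.

(** Pythagoras for k_y and i k_y: c bounds the squared norms of the residuals, and
the squared coordinates along es add up to the total energy at y. *)
Lemma kernel_energy_le (es : seq E) (c : R) y : orthonormal (H : set E) ip es ->
  (forall t w, w = kernel_at k y t - proj ip es (kernel_at k y t) -> ip w w <= c) ->
  2 * complex.Re (k y y) <= 2 * c + total_energy es y.
Proof.
move=> ones wc; have sH := hilbert_subspace hilb; have ipi := ip_inner hilb.
have Hk := kernel_at_mem hilb repr.
have kE t : complex.Re (k y y) <= c + \sum_(e <- es) ip (kernel_at k y t) e ^+ 2.
  rewrite -(kernel_at_norm hilb repr y t).
  by rewrite (orthonormal_pythagoras sH ipi ones)// lerD2r; exact: wc.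
have -> : total_energy es y =
    \sum_(e <- es) ip (kernel_at k y true) e ^+ 2 +
    \sum_(e <- es) ip (kernel_at k y false) e ^+ 2.
  rewrite -big_split; apply: eq_big_seq => e ees.
  have He := orthonormal_mem ones ees.
  rewrite /energy (rdot_ip hilb repr)// big_bool -!expr2.
  by rewrite !(inner_sym ipi (Hk y _) He).
have := kE true; have := kE false; lra.
Qed.

(** The threshold for the tail in the homogeneous approximation property is A e / 2,
so that the residual of k_y has squared norm at most e / 2; the other half of e
absorbs the shell. *)
Lemma sampling_trace_le_density (Lam : set X) : sampling mu H Lam ->
  forall e : R, 0 < e -> exists r0 : R, forall r, r0 <= r -> forall x,
  (averaged_trace mu k x r <=
   counting (Lam `&` ball x r) / mu (ball x r) + e%:E)%E.
Proof.
move=> [A [B [A0 B0 samp]]] e e0.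
have [C C0 kC] := kernel_diagonal_bounds.
have bes : bessel mu H Lam by exists B => f /samp[].
have Ae0 : 0 < A * e / 2 by rewrite divr_gt0// mulr_gt0.
have [rho rho0 hap] := kernel_hap kern bes (etrans (sqrtr_gt0 _) Ae0).
rewrite sqr_sqrtr ?ltW// in hap.
have e'0 : 0 < e / (2 * C) by rewrite divr_gt0// mulr_gt0.
have [r1 r1P] := annulus_decay geom rho e'0.
have [r2 r20 vpos] := volume_gt0 geom.
exists (Num.max r1 r2 + rho) => r; rewrite -lerBrDr ge_max => /andP[r1r r2r] x.
pose s := r - rho; rewrite -/s in r1r r2r.
have sr : s <= r by rewrite /s gerBl ltW.
have s0 : 0 < s := lt_le_trans r20 r2r.
have r0 : 0 < r := lt_le_trans s0 sr.
have vr := vpos r (le_trans r2r sr) x; have vs := vpos s r2r x.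
have [fin|inf] := pselect (finite_set (Lam `&` ball x r)); last first.
  (* infinitely many points: the quotient is +oo *)
  rewrite /counting asboolF// volumeE// inver gt_eqF// gt0_mulye ?lte_fin ?invr_gt0//.
  by rewrite addye// leey.
have [q [_ qE qs]] := finite_set_seq R fin.
have qLam : [set` q] `<=` Lam by rewrite qs; exact: subIsetl.
have [es [ses ones app]] := frame_approximation hilb repr A0 samp qLam.
have mB t : measurable (ball x t : set X) by exact: (measurable_ball geom).
have trace := @local_trace_le C (e / 2) es (ball x r) (ball x s) (mB r) (mB s)
  (le_ball sr) (ltW C0) (ltW (divr_gt0 e0 (ltr0Sn _ _))) kC ones.
rewrite /averaged_trace volumeE// inver gt_eqF// lee_pdivrMr//.
apply: le_trans (trace _) _ => [y xy|].
  apply: kernel_energy_le => // t w wE.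
  rewrite -(ler_pM2l A0) [leRHS]mulrA -lee_fin.
  apply: le_trans (app _ _ _ wE) _; apply: le_trans (ltW hap).
  apply: le_trans; last by apply: ereal_sup_ubound; exists y.
  apply: esum_le_subset => // [l [Ll]|l _].
    rewrite qs => nl; split => // yl; apply: nl; split => //.
    have := ball_triangle xy yl.
    by rewrite /s subrK.
  by rewrite sqmodE lee_fin addr_ge0// -expr2 sqr_ge0.
have ann : (mu (ball x r `\` ball x s) <= (e / (2 * C) * volume mu x s)%:E)%E.
  by have := r1P s r1r x; rewrite /s subrK.
have vsr : volume mu x s <= volume mu x r.
  rewrite -lee_fin -!volumeE//.
  by apply: le_measure; [exact/mem_set/mB|exact/mem_set/mB|exact: le_ball].
rewrite volumeE// -qE -EFinM muleDl// -!EFinM mulfVK ?gt_eqF//.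
rewrite inver pnatr_eq0/= -EFinM -!EFinD.
apply: (@le_trans _ _ ((e / 2 * volume mu x r + (size es)%:R / 2)%:E +
   C%:E * (e / (2 * C) * volume mu x s)%:E)%E).
  by apply: leeD => //; apply: lee_pmul => //; rewrite lee_fin ltW.
rewrite -EFinM -EFinD lee_fin.
have : (size es)%:R <= (size q)%:R * 2 :> R by rewrite -natrM ler_nat.
have -> : C * (e / (2 * C) * volume mu x s) = e / 2 * volume mu x s.
  by field; rewrite gt_eqF.
have : e / 2 * volume mu x s <= e / 2 * volume mu x r.
  by apply: ler_wpM2l => //; rewrite divr_ge0// ltW.
lra.
Qed.

End sampling.

(** * Interpolation: uniformly bounded interpolants *)

Section gliding_hump.
Context {R : realType} {d : measure_display} {X : measurableType d}.
Local Notation E := (X -> Rcomplex R).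
Variable mu : {measure set X -> \bar R}.
Variables (H : set (X -> R[i])).
Hypothesis hilb : hilbert_space_of_functions mu H.
Local Notation ip := (real_inner mu).
Variable Lam : set X.
Hypothesis interp : interpolation H Lam.

Definition hump_size (n : nat) : R := (2 ^ n.+1)%:R^-1.

Lemma hump_size_gt0 n : 0 < hump_size n.
Proof. by rewrite invr_gt0 ltr0n expn_gt0. Qed.

(** The squares of the humps are dominated by the geometric sequence 2^-(n+1). *)
Lemma sparse_summable (l : nat -> X) (a : X -> R[i]) : injective l ->
  (forall n, a (l n) = (hump_size n *: (1 : Rcomplex R))) ->
  (forall y, ~ range l y -> a y = 0) ->
  (\esum_(y in Lam) sqmod (a y) < +oo)%E.
Proof.
move=> linj al a0.
have sq0 z : (0 <= sqmod z :> \bar R)%E.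
  by rewrite sqmodE lee_fin addr_ge0// -expr2 sqr_ge0.
rewrite (esumID (range l))// [X in (_ + X)%E]esum1 ?adde0; last first.
  by move=> y [_ /a0 ->]; rewrite sqmodE /rdot /= mul0r addr0.
apply: (@le_lt_trans _ _ (\esum_(y in range l) sqmod (a y))%E).
  by apply: esum_le_subset => //; exact: subIsetr.
rewrite esum_image; last by move=> i j _ _; exact: linj.
rewrite -nneseries_esumT//.
apply: le_lt_trans (ltry 1); apply: (le_trans _ (epsilon_trick0 xpredT (@ler01 R))).
apply: lee_nneseries => n _ //.
rewrite al sqmodE lee_fin /rdot/= mulr0 mul0r addr0 mulr1 mul1r.
rewrite ger_pMl ?hump_size_gt0//.
by rewrite invf_le1 ?ltr0n ?expn_gt0// ler1n expn_gt0.
Qed.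

Lemma delta_interpolant (l : X) : exists f : E, Lam l ->
  H f /\ forall y, Lam y -> f y = (y == l)%:R.
Proof.
have [Ll|nLl] := pselect (Lam l); last by exists 0.
have [|f Hf fl] := interp (a := fun y => (y == l)%:R); last by exists f.
have sq0 z : (0 <= sqmod z :> \bar R)%E.
  by rewrite sqmodE lee_fin addr_ge0// -expr2 sqr_ge0.
rewrite (esumID [set l])// [X in (_ + X)%E]esum1 ?adde0; last first.
  by move=> y [_ /eqP/negPf ->]; rewrite sqmodE /rdot /= mul0r addr0.
rewrite setIidr; last by move=> _ ->.
by rewrite esum_set1// sqmodE ltry.
Qed.

Definition delta_on (l : X) (F : seq X) (f : E) :=
  forall y, y \in F -> Lam y -> f y = (y == l)%:R.

(** Gliding hump. Otherwise choose inductively points l n and finite sets F n such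
that interpolating the unit vector at l n on F n costs more than a constant
which depends on the previous choices, and such that l n avoids the previous
sets. The data equal to hump_size n at l n are square summable. If f interpolates
them, subtract from f the interpolants of the previous humps and divide by
hump_size n: the result interpolates the unit vector at l n on F n, since later
humps do not meet F n. This forces ip f f to exceed every n. *)
Lemma interpolation_uniform : exists C : R, forall l (F : seq X), Lam l ->
  exists2 f : E, H f /\ delta_on l F f & ip f f <= C.
Proof.
have sH := hilbert_subspace hilb; have ipi := ip_inner hilb.
apply: contrapT => nC.
have {nC} /choice[p pP] : forall C : R, exists lF : X * seq X, Lam lF.1 /\
    forall f : E, H f -> delta_on lF.1 lF.2 f -> C < ip f f.
  move=> C; apply: contrapT => nlF; apply: nC; exists C => l F Ll.
  apply: contrapT => nf; apply: nlF; exists (l, F); split=> // f Hf fF.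
  by rewrite ltNge; apply/negP => fC; apply: nf; exists f.
have /choice[phi phiP] := delta_interpolant.
pose g (s : seq (X * seq X)) : E :=
  \sum_(0 <= i < size s) hump_size i *: phi (nth (p 0) s i).1.
(* G collects the points and sets used so far, g the humps used so far *)
pose G (s : seq (X * seq X)) := flatten [seq lF.1 :: lF.2 | lF <- s].
pose bound (s : seq (X * seq X)) :=
  (2 * (size s)%:R + 2 * ip (g s) (g s)) / hump_size (size s) ^+ 2 +
  \sum_(y <- G s) `|ip (phi y) (phi y)|.
have [q qE] : exists q : nat -> X * seq X, forall n, q n = p (bound (mkseq q n)).
  pose fix hist (n : nat) :=
    if n is m.+1 then rcons (hist m) (p (bound (hist m))) else [::].
  exists (fun n => p (bound (hist n))) => n; congr (p (bound _)).
  by elim: n => // n IHn; rewrite mkseqS -IHn.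
have {}pP n : Lam (q n).1 /\ forall f : E, H f -> delta_on (q n).1 (q n).2 f ->
    bound (mkseq q n) < ip f f by rewrite qE; exact: pP.
pose l n := (q n).1.
have Ll n : Lam (l n) by exact: (pP n).1.
have gE n : g (mkseq q n) = \sum_(0 <= i < n) hump_size i *: phi (l i).
  rewrite /g size_mkseq big_nat [RHS]big_nat; apply: eq_bigr => i /= ilt.
  by rewrite nth_mkseq.
have Hg n : H (g (mkseq q n)).
  by rewrite gE; apply: (subspace_sum sH) => i _; exact: (phiP _ (Ll i)).1.
(* an interpolant of the unit vector at a point of G is cheaper than bound *)
have lG n : l n \notin G (mkseq q n).
  apply/negP => lnG; have [Hphi philn] := phiP _ (Ll n).
  have : bound (mkseq q n) < ip (phi (l n)) (phi (l n)).
    by apply: (pP n).2 => // y _ Ly; exact: philn.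
  apply/negP; rewrite -leNgt; apply: le_trans (ler_norm _) _.
  apply: (@le_trans _ _ (\sum_(y <- G (mkseq q n)) `|ip (phi y) (phi y)|)).
    by rewrite (big_rem _ lnG)/= lerDl sumr_ge0.
  have ig := inner_ge0 ipi (Hg n).
  by rewrite lerDr divr_ge0 ?sqr_ge0// addr_ge0// mulr_ge0.
have inG m n y : (m < n)%N -> y \in l m :: (q m).2 -> y \in G (mkseq q n).
  move=> mn yq; apply/flattenP; exists (l m :: (q m).2) => //.
  apply/mapP; exists (q m) => //.
  by apply/mapP; exists m => //; rewrite mem_iota.
have lneq m n : (m < n)%N -> l m != l n.
  move=> mn; apply: contraNneq (lG n) => <-.
  by apply: (inG m) => //; exact: mem_head.
have linj : injective l.
  move=> m n lmn; have [mn|nm|//] := ltngtP m n.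
    by have := lneq _ _ mn; rewrite lmn eqxx.
  by have := lneq _ _ nm; rewrite lmn eqxx.
pose a y : Rcomplex R := if pselect (exists n, l n = y) is left P
  then hump_size (projT1 (cid P)) *: 1 else 0.
have al n : a (l n) = hump_size n *: 1.
  rewrite /a; case: pselect => [P|]; last by case; exists n.
  by case: cid => m /= /linj ->.
have a0 y : ~ range l y -> a y = 0.
  by rewrite /a; case: pselect => // P []; case: P => n ly; exists n.
have [f Hf fa] : exists2 f : E, H f & forall y, Lam y -> f y = a y.
  by have [f] := interp (sparse_summable linj al a0); exists f.
pose n := (Num.truncn (ip f f)).+1.
have nf : ip f f < n%:R by rewrite /n truncnS_gt.
have tn := hump_size_gt0 n.
pose h : E := (hump_size n)^-1 *: (f - g (mkseq q n)).
have Hfg : H (f - g (mkseq q n) : E) by exact: subspaceB sH _ _ Hf (Hg n).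
have Hh : H h by exact: subspaceZ.
have hdelta : delta_on (l n) (q n).2 h.
  move=> y yF Ly; rewrite /h -[LHS]/((hump_size n)^-1 *: (f y - g (mkseq q n) y)).
  suff -> : f y - g (mkseq q n) y = hump_size n *: (y == l n)%:R.
    by rewrite scalerA mulVf ?gt_eqF// scale1r.
  rewrite fa// gE fct_sumE.
  have -> : \sum_(0 <= i < n) (hump_size i *: phi (l i)) y =
      \sum_(0 <= i < n) hump_size i *: (y == l i)%:R.
    by apply: eq_bigr => i _; rewrite -[LHS]/(_ *: phi (l i) y) (phiP _ (Ll i)).2.
  have [[m _ my]|nr] := pselect (range l y); last first.
    rewrite a0// big1 ?subrr ?subr0.
      have /negPf -> : y != l n by apply/eqP => yl; apply: nr; exists n.
      by rewrite scaler0.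
    move=> i _; have /negPf -> : y != l i by apply/eqP => yl; apply: nr; exists i.
    by rewrite scaler0.
  rewrite -my al; have [mn|nm|<-] := ltngtP m n.
  - rewrite (bigD1_seq m) ?mem_index_iota ?iota_uniq//= eqxx big1 ?addr0 ?subrr.
      by rewrite (negPf (lneq _ _ mn)) scaler0.
    by move=> i im; rewrite (inj_eq linj) eq_sym (negPf im) scaler0.
  - have := lG m; rewrite (inG n)// in_cons my yF orbT//.
  - rewrite eqxx big_nat big1 ?subr0// => i /= im.
    by rewrite eq_sym (negPf (lneq _ _ im)) scaler0.
have := (pP n).2 h Hh hdelta; apply/negP; rewrite -leNgt.
have sum0 : 0 <= \sum_(y <- G (mkseq q n)) `|ip (phi y) (phi y)| by exact: sumr_ge0.
rewrite /h (innerZl sH ipi)// (innerZr sH ipi)// /bound size_mkseq.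
apply: le_trans (_ : (2 * n%:R + 2 * ip (g (mkseq q n)) (g (mkseq q n))) /
  hump_size n ^+ 2 <= _); last by rewrite lerDl.
rewrite mulrA -expr2 exprVn mulrC ler_pM2r ?invr_gt0 ?exprn_gt0//.
have := innerB_le sH ipi Hf (Hg n); lra.
Qed.

End gliding_hump.

(** * Interpolation: the density is at most the averaged trace *)

Section interpolation.
Context {R : realType} {d : measure_display} {X : metricMeasurableType R d}.
Local Notation E := (X -> Rcomplex R).
Variable mu : {measure set X -> \bar R}.
Variables (H : set (X -> R[i])) (k : X -> X -> R[i]).
Hypothesis geom : geometric_assumptions mu.
Hypothesis hilb : hilbert_space_of_functions mu H.
Hypothesis repr : reproducing_kernel mu H k.
Hypothesis kern : kernel_assumptions mu H k.
Local Notation ip := (real_inner mu).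
Local Notation ip_on D := (form (integral_on mu D)).

Lemma ip_imaginary (f : E) : ip (fun x => 'i%C * f x) (fun x => 'i%C * f x) = ip f f.
Proof.
rewrite /real_inner /form !subrr; congr ((fine (integral_on mu _ _) - _) / _).
by apply/funext => y; rewrite /energy !fctE; case: (f y) => a b; rewrite /rdot/=; ring.
Qed.

(** The index set counts each point twice, once for k_l and once for i k_l; the
uniform interpolant of l, multiplied by i in the second case, is dual to these
vectors, and biorthogonal_exists moves it into their span. The last bound is
biorthogonal_kernel_bound for k_y and i k_y. *)
Lemma kernel_dual_system (Lam : set X) (C : R) (s : seq X) :
  (forall l (F : seq X), Lam l -> exists2 f : E, H f /\ delta_on Lam l F f & ip f f <= C) ->
  uniq s -> [set` s] `<=` Lam ->
  exists g : 'I_(size s) * bool -> E, let v i := kernel_at k (tnth (in_tuple s) i.1) i.2 in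
  [/\ forall i, H (g i), forall i, ip (v i) (g i) = 1, forall i, ip (g i) (g i) <= C &
    forall y, 0 <= \sum_i rdot (v i y) (g i y) <= 2 * complex.Re (k y y)].
Proof.
move=> unif us sLam; have sH := hilbert_subspace hilb; have ipi := ip_inner hilb.
have Hk := kernel_at_mem hilb repr.
pose pt (i : 'I_(size s)) := tnth (in_tuple s) i.
have pts i : pt i \in s by exact: mem_tnth.
have /choice[f fP] : forall i, exists f : E, [/\ H f, delta_on Lam (pt i) s f & ip f f <= C].
  by move=> i; have [f [Hf fd] fC] := unif (pt i) s (sLam _ (pts i)); exists f.
pose v (i : 'I_(size s) * bool) : E := kernel_at k (pt i.1) i.2.
pose F (i : 'I_(size s) * bool) : E := if i.2 then (fun x => 'i%C * f i.1 x) else f i.1.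
have HF i : H (F i).
  rewrite /F; have [Hf _ _] := fP i.1; case: ifP => // _.
  exact: (hilbert_imaginary hilb).
have Hv i : H (v i) by exact: Hk.
have vF i j : ip (v i) (F j) = (i == j)%:R.
  rewrite (inner_sym ipi)// -(reproducing hilb repr)//.
  case: i j => [i t] [j t'] /=.
  have [_ fd _] := fP j; have := fd (pt i) (pts i) (sLam _ (pts i)).
  have -> : (pt i == pt j) = (i == j).
    by rewrite /pt !(tnth_nth (pt i)) /= nth_uniq.
  rewrite xpair_eqE /F /= => fij.
  by case: t t' => -[]; rewrite /= fij; case: (i == j) => /=; ring.
have [g [Hg vg span gC]] := biorthogonal_exists sH ipi Hv HF vF.
exists g; split => // [i|i|y].
- by rewrite vg eqxx.
- apply: le_trans (gC i) _; have [_ _] := fP i.1.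
  by rewrite /F; case: ifP => _ //; rewrite ip_imaginary.
pose S t := \sum_i ip (v i) (kernel_at k y t) * ip (g i) (kernel_at k y t).
have -> : \sum_i rdot (v i y) (g i y) = S true + S false.
  rewrite -big_split; apply: eq_bigr => i _.
  by rewrite (rdot_ip hilb repr)// big_bool.
have bnd t : 0 <= S t <= complex.Re (k y y).
  rewrite -(kernel_at_norm hilb repr y t).
  exact: (biorthogonal_kernel_bound sH ipi Hv Hg (Hk y t) vg span).
have := bnd true; have := bnd false; lra.
Qed.

(** S is the diagonal of the kernel of the span of the k_l for l in s. Each of the
2 #s products <k_l, g_l> equals 1, and its part outside D is at most delta by
Cauchy-Schwarz, localization of k_l and the bound on g_l. *)
Lemma interpolation_card_le (Lam : set X) (C delta eps2 rho : R) (s : seq X) (D : set X) :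
  (forall l (F : seq X), Lam l -> exists2 f : E, H f /\ delta_on Lam l F f & ip f f <= C) ->
  0 <= delta -> eps2 * C <= delta ^+ 2 ->
  (forall x, (\int[mu]_(y in ~` ball x rho) sqmod (k x y) <= eps2%:E)%E) ->
  uniq s -> [set` s] `<=` Lam -> measurable D ->
  (forall x, x \in s -> ball x rho `<=` D) ->
  exists S : X -> R, [/\ measurable_fun setT S,
    forall y, 0 <= S y <= complex.Re (k y y) &
    (((size s)%:R * (1 - delta))%:E <= integral_on mu D S)%E].
Proof.
move=> unif d0 eC loc us sLam mD sD.
have sH := hilbert_subspace hilb; have ipi := ip_inner hilb.
have [g] := kernel_dual_system unif us sLam.
set v : 'I_(size s) * bool -> E := fun i => kernel_at k (tnth (in_tuple s) i.1) i.2.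
move=> /= [Hg vg gC Sk].
have Hv i : H (v i) by exact: (kernel_at_mem hilb repr).
pose S y := \sum_i rdot (v i y) (g i y).
have mS : measurable_fun setT S.
  by apply: measurable_sum => i; exact: (measurable_rdot hilb).
have S0 y : 0 <= S y by case/andP: (Sk y).
have mCD := measurableC mD; have pD := integral_on_positive mu mD.
have half0 : 0 <= 2^-1 :> R by rewrite invr_ge0.
have [mS2 S2E] := functionalZ pD half0 mS S0.
exists (fun y => 2^-1 * S y); split => // [y|].
  by apply/andP; split; [exact: mulr_ge0|have := Sk y; rewrite -/(S y); lra].
rewrite S2E (form_sum pD sH (energy_integrable hilb mD))// -EFinM lee_fin.
have out i : ip_on (~` D) (v i) (g i) <= delta.
  have ipo := ip_on_inner hilb mCD.
  have cs := cauchy_schwarz sH ipo (Hv i) (Hg i).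
  have g1 : ip_on (~` D) (g i) (g i) <= C by apply: le_trans (gC i); exact: (ip_on_le hilb).
  have v1 : ip_on (~` D) (v i) (v i) <= eps2.
    pose l := tnth (in_tuple s) i.1.
    rewrite -lee_fin -(ip_on_diag hilb mCD)//; apply: le_trans (loc l).
    have -> : (\int[mu]_(y in ~` ball l rho) sqmod (k l y))%E =
        integral_on mu (~` ball l rho) (energy (v i)).
      by apply: eq_integral => y _; rewrite -(energy_kernel_at repr _ i.2).
    have [me _] := energy_integrable hilb mCD (Hv i).
    apply: ge0_subset_integral => //.
    + by apply: measurableC; exact: (measurable_ball geom).
    + by apply/measurable_EFinP; exact: measurable_funS me.
    + by move=> y _; rewrite lee_fin energy_ge0.
    + by apply: subsetC; apply: sD; exact: mem_tnth.
  have v0 := inner_ge0 ipo (Hv i); have g0 := inner_ge0 ipo (Hg i).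
  rewrite leNgt; apply/negP => dlt.
  have : ip_on (~` D) (v i) (g i) ^+ 2 <= delta ^+ 2.
    by apply: (le_trans cs); apply: le_trans eC; exact: ler_pM.
  by rewrite ler_sqr ?nnegrE ?(ltW (le_lt_trans d0 dlt))// leNgt dlt.
have -> : (size s)%:R * (1 - delta) = 2^-1 * \sum_(i : 'I_(size s) * bool) (1 - delta).
  by rewrite sumr_const card_prod card_ord card_bool -[_ *+ (_ * _)]mulr_natl natrM; field.
rewrite ler_pM2l ?invr_gt0//.
apply: ler_sum => i _; have := out i; have := ip_on_split hilb mD (Hv i) (Hg i).
by rewrite vg; lra.
Qed.

(** With N = #s, delta and eta are chosen so that N <= T + e V, where V is the volume
of the ball, T the integral of k y y over it and K a bound for k y y: the shell
costs K eta V <= e V / 2, and the crude bound N <= 4 K V gives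
delta N <= e V / 2. *)
Lemma interpolation_density_le_trace (Lam : set X) : interpolation H Lam ->
  forall e : R, 0 < e -> exists r0 : R, forall r, r0 <= r -> forall x,
  (counting (Lam `&` ball x r) / mu (ball x r) <=
   averaged_trace mu k x r + e%:E)%E.
Proof.
move=> interp e e0.
have [K K0 kK] := kernel_diagonal_bounds kern.
have [C' unif'] := interpolation_uniform hilb interp.
pose C := `|C'| + 1.
have C0 : 0 < C by rewrite /C ltr_pwDr.
have unif l (F : seq X) : Lam l -> exists2 f : E, H f /\ delta_on Lam l F f & ip f f <= C.
  move=> Ll; have [f Hf fC] := unif' l F Ll; exists f => //.
  by apply: (le_trans fC); rewrite /C; have := ler_norm C'; lra.
pose delta := Num.min (1 / 2) (e / (8 * K)).
have d0 : 0 < delta by rewrite lt_min !divr_gt0// mulr_gt0.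
have d1 : delta <= 1 / 2 by rewrite ge_min lexx.
have d2 : delta * (8 * K) <= e.
  by rewrite -ler_pdivlMr ?mulr_gt0// ge_min lexx orbT.
pose eta := Num.min 1 (e / (2 * K)).
have eta0 : 0 < eta by rewrite lt_min ltr01 divr_gt0// mulr_gt0.
have eta1 : eta <= 1 by rewrite ge_min lexx.
have eta2 : eta * (2 * K) <= e.
  by rewrite -ler_pdivlMr ?mulr_gt0// ge_min lexx orbT.
have eps0 : 0 < Num.sqrt (delta ^+ 2 / C) by rewrite sqrtr_gt0 divr_gt0// exprn_gt0.
have [rho rho0 loc'] := kernel_localization kern eps0.
rewrite sqr_sqrtr ?divr_ge0 ?sqr_ge0 ?ltW// in loc'.
have loc x : (\int[mu]_(y in ~` ball x rho) sqmod (k x y) <= (delta ^+ 2 / C)%:E)%E.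
  by apply: le_trans (ltW loc'); apply: ereal_sup_ubound; exists x.
have [r1 r1P] := annulus_decay geom rho eta0.
have [r2 r20 vpos] := volume_gt0 geom.
exists (Num.max r1 r2) => r; rewrite ge_max => /andP[r1r r2r] x.
have r0 : 0 < r := lt_le_trans r20 r2r.
have vr := vpos r r2r x; set V := volume mu x r in vr.
have mB t : measurable (ball x t : set X) by exact: (measurable_ball geom).
set T := (\int[mu]_(y in ball x r) (complex.Re (k y y))%:E)%E.
have T0 : (0 <= T)%E.
  by apply: integral_ge0 => y _; rewrite lee_fin; case/andP: (kK y).
have TV : (T <= (K * V)%:E)%E.
  rewrite EFinM -volumeE// -integral_cst//; apply: ge0_integral_le => y _.
    by rewrite lee_fin; case/andP: (kK y).
  by rewrite lee_fin; case/andP: (kK y).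
have Tfin : T \is a fin_num.
  by rewrite ge0_fin_numE//; exact: le_lt_trans TV (ltry _).
have card_le (s : seq X) : uniq s -> [set` s] `<=` Lam `&` ball x r ->
    (size s)%:R <= fine T + e * V.
  move=> us sL.
  have sLam : [set` s] `<=` Lam by move=> y /sL[].
  have [|y ys z yz|S [mS Sk +]] := interpolation_card_le unif (ltW d0) _ loc us sLam
    (mB (r + rho)).
  - by rewrite mulfVK// gt_eqF.
  - by have [_ xy] := sL y ys; exact: ball_triangle xy yz.
  have S0 y : 0 <= S y by case/andP: (Sk y).
  have mE (D : set X) : measurable D -> measurable_fun D (EFin \o S).
    by move=> mD; apply/measurable_EFinP; exact: measurable_funS mS.
  have sub : ball x r `<=` ball x (r + rho) by apply: le_ball; rewrite lerDl ltW.
  have mA : measurable (ball x (r + rho) `\` ball x r) by exact: measurableD.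
  have SB : (integral_on mu (ball x r) S <= T)%E.
    by apply: ge0_integral_le => y _; rewrite lee_fin//; case/andP: (Sk y).
  have SA : (integral_on mu (ball x (r + rho) `\` ball x r) S <= (K * (eta * V))%:E)%E.
    apply: (@le_trans _ _ (K%:E * mu (ball x (r + rho) `\` ball x r))%E).
      rewrite -integral_cst//; apply: ge0_integral_le => y _; first by rewrite lee_fin.
      rewrite lee_fin; case/andP: (Sk y) => _ /le_trans; apply.
      by case/andP: (kK y).
    rewrite [leRHS]EFinM; apply: lee_pmul => //; first by rewrite lee_fin ltW.
    exact: r1P.
  have -> : integral_on mu (ball x (r + rho)) S =
     (integral_on mu (ball x r) S + integral_on mu (ball x (r + rho) `\` ball x r) S)%E.
    rewrite /integral_on -[in LHS](setDUK sub) ge0_integral_setU//.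
    + by rewrite setDUK//; exact: mE.
    + by move=> y _; rewrite lee_fin.
    + by rewrite disj_set2E setDIK.
  move=> /le_trans/(_ (leeD SB SA)).
  rewrite -(fineK Tfin) -EFinD lee_fin.
  have fTV : fine T <= K * V by rewrite -lee_fin fineK.
  have n0 : 0 <= (size s)%:R :> R by [].
  have etaV : eta * (2 * K) * V <= e * V by apply: ler_wpM2r => //; exact: ltW.
  have dV : delta * (8 * K) * V <= e * V by apply: ler_wpM2r => //; exact: ltW.
  have etaV1 : K * (eta * V) <= K * V.
    by apply: ler_wpM2l; [exact: ltW|rewrite ger_pMl].
  set N : R := (size s)%:R in n0 *.
  have dN : N * delta <= N * (1 / 2) by apply: ler_wpM2l.
  move=> main.
  have N4 : N <= 4 * K * V by lra.
  have : N * delta <= 4 * K * V * delta by apply: ler_wpM2r => //; exact: ltW.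
  lra.
(* the bound on finite parts rules out infinitely many points *)
have [fin|inf] := pselect (finite_set (Lam `&` ball x r)); last first.
  have [F FL] := infinite_set_fset (Num.truncn (fine T + e * V)).+1 inf.
  move=> Fn; exfalso; have := card_le _ (fset_uniq F) FL.
  apply/negP; rewrite -ltNge; apply: lt_le_trans (truncnS_gt _) _.
  by rewrite ler_nat.
have [q [uq qE qs]] := finite_set_seq R fin.
have := card_le q uq; rewrite qs => /(_ (@subset_refl _ _)) qle.
rewrite /averaged_trace volumeE// inver gt_eqF// lee_pdivrMr// -qE.
by rewrite -/T -(fineK Tfin) -EFinM lee_fin mulrDl mulfVK ?gt_eqF//.
Qed.
End interpolation.

(** * Densities and averaged traces *)

Local Open Scope ereal_scope.

Theorem theorem2p2 (R : realType) (d : measure_display)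
  (X : metricMeasurableType R d) (mu : {measure set X -> \bar R})
  (H : set (X -> R[i])) (k : X -> X -> R[i])
  (geom : geometric_assumptions mu)
  (hilb : hilbert_space_of_functions mu H)
  (repr : reproducing_kernel mu H k)
  (kern : kernel_assumptions mu H k) :
  (forall Lam : set X, sampling mu H Lam ->
     lower_trace mu k <= lower_density mu Lam /\
     upper_trace mu k <= upper_density mu Lam) /\
  (forall Lam : set X, interpolation H Lam ->
     lower_density mu Lam <= lower_trace mu k /\
     upper_density mu Lam <= upper_trace mu k).
Proof.
split=> Lam hLam.
- have cmp := sampling_trace_le_density geom hilb repr kern hLam.
  by split; [exact: limf_einf_inf_le cmp|exact: limf_esup_sup_le cmp].
- have cmp := interpolation_density_le_trace geom hilb repr kern hLam.
  by split; [exact: limf_einf_inf_le cmp|exact: limf_esup_sup_le cmp].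
Qed.
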